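(* (i) For each $n<\omega$ and each ordinal $\Omega\geq \omega_{n+2}$, $$\mathrm{Log}(\Omega;\vartheta_0,\dots,\vartheta_n;\mathcal{H}_n(\Omega))=\mathrm{GLP}_n.$$ (ii) For each ordinal $\Omega\geq\varepsilon_0$, $\mathrm{Log}\big(\Omega;(\vartheta_n)_{n<\omega};\bigcup_{n<\omega}\mathcal{H}_n(\Omega)\big)=\mathrm{GLP}$.
   Context: Ordinals: $\omega_0=1$, $\omega_{k+1}=\omega^{\omega_k}$, and $\varepsilon_0=\sup_k\omega_k$. The function $\ell$ on ordinals: $\ell(0)=0$ and $\ell(\alpha)=\beta$ if $\alpha=\gamma+\omega^\beta$ for some $\gamma$ (i.e. $\beta$ is the exponent of the last term of the Cantor normal form); $\ell^m$ is its $m$-th iterate. For an ordinal $\Omega$: $\vartheta_0$ is the interval topology on $\Omega$ (generated by $\{0\}$ and all intervals $(\alpha,\beta)$, $\alpha<\beta\le\Omega$), and $\vartheta_n$ is the topology generated by $\vartheta_0$ together with all sets $U^m_\beta(\Omega)=\{\alpha\in\Omega:\ell^m(\alpha)>\beta\}$ for $m\le n$, $\beta$ an ordinal. $d_n$ denotes the derivative (set of limit points) operator of $\vartheta_n$. Transfinite words: a word is a map $A:\alpha\to\{0,1\}$, $|A|=\alpha$; concatenation $AB$ and iteration $A^\beta$ ($A^0$ empty, $A^{\beta+1}=A^\beta A$, unions at limits) are defined naturally. A word $X$ is periodic if $X=A^\lambda$ for a limit ordinal $\lambda$ and a nonempty word $A$; $X$ is ultimately periodic (u.p.) if $X=BY$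 with $Y$ periodic. A set $X$ of ordinals is u.p. in $\Omega$ if the $\Omega$-word given by the characteristic function of $X\cap\Omega$ is u.p.; $X\subseteq\Omega$ is hereditarily periodic (h.p.) in $\Omega$ if $X$ is u.p. in every limit ordinal $\beta\le\Omega$. $\mathcal{H}_0(\Omega)$ is the set of subsets of $\Omega$ h.p. in $\Omega$. Define $\mathcal{V}_0(\Omega)=\mathcal{H}_0(\Omega)$, $\mathcal{V}_{n+1}(\Omega)=\{B\cap\ell^{-1}(A):B\in\mathcal{H}_0(\Omega),A\in\mathcal{V}_n(\Omega)\}$ (preimages taken in $\Omega$), and $\mathcal{H}_n(\Omega)$ the closure of $\mathcal{V}_n(\Omega)$ under finite unions. $\mathrm{GLP}$ is the modal logic with modalities $[n]$, $n\in\omega$ ($\langle n\rangle=\neg[n]\neg$), axioms: boolean tautologies, $[n](\varphi\to\psi)\to([n]\varphi\to[n]\psi)$, $[n]([n]\varphi\to\varphi)\to[n]\varphi$, $\langle m\rangle\varphi\to[n]\langle m\rangle\varphi$ for $m<n$, $[m]\varphi\to[n]\varphi$ for $m\le n$; rules modus ponens and $\varphi\vdash[n]\varphi$. $\mathrm{GLP}_n$ is its fragment in the language with modalities $[0],\dots,[n]$. For a set $X$ with topologies $\tau_i$ and a family $\mathcal A\subseteq\mathcal P(X)$ closed under boolean operations and the derivative operators $d_{\tau_i}$, $\mathrm{Log}(X;(\tau_i);\mathcal A)$ is the set of formulas $\varphi$ such that $v(\varphi)=X$ for every valuation $v$ of propositional variables in $\mathcal A$, where boolean connectives are interpreted set-theoretically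 and $\langle i\rangle$ as $d_{\tau_i}$. *)

(* Defs.v *)
From HB Require Import structures.
From mathcomp Require Import all_boot all_order.
From mathcomp Require Import generic_quotient.
From mathcomp Require Import all_classical topology.

Set Implicit Arguments.
Unset Strict Implicit.
Unset Printing Implicit Defensive.

Import Order.TTheory.
Local Open Scope order_scope.
Local Open Scope classical_set_scope.

(** * Ordinals

    A well-founded tree [node A f] denotes the least ordinal greater than
    those denoted by the [f a].  Trees denoting the same ordinal are identified,
    so that [=] on [Ord] is equality of ordinals.  [Ord] contains the order types
    of all well-orders on types of the universe [tree] quantifies over. *)

Inductive tree : Type := node (A : Type) (f : A -> tree).

Fixpoint tle (s t : tree) {struct s} : Prop :=
  let: node A f := s in let: node B g := t in
  forall a, exists b, tle (f a) (g b).

Definition tlt (s t : tree) : Prop :=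
  let: node B g := t in exists b, tle s (g b).

Lemma tle_refl s : tle s s.
Proof. by elim: s => A f IH a; exists a; exact: IH. Qed.

Lemma tle_trans s t u : tle s t -> tle t u -> tle s u.
Proof.
elim: s t u => A f IH [B g] [C h] st tu a.
have [b ab] := st a; have [c bc] := tu b; exists c; exact: IH ab bc.
Qed.

Lemma tle_child A (f : A -> tree) a : tle (f a) (node f).
Proof.
suff child t : (let: node B g := t in forall b, tle (g b) t) by exact: (child (node f) a).
elim: t => {f a}A f IH a /=.
by have := IH a; case E: (f a) => [C h] IHa c; exists a; rewrite E; exact: IHa.
Qed.

Lemma tle_or_tlt s t : tle s t \/ tlt t s.
Proof.
elim: s t => A f IH [B g].
have [[a na]|all] := pselect (exists a, forall b, ~ tle (f a) (g b)).
  right; exists a; have IHa t := IH a t; move: na IHa.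
  by case: (f a) => C h na IHa b; case: (IHa (g b)) => // /na.
left=> a; apply: contrapT => na; apply: all; exists a => b ab.
by apply: na; exists b.
Qed.

Lemma tlt_le s t : tlt s t -> tle s t.
Proof. by case: t => B g [b sb]; exact: tle_trans sb (tle_child _ _). Qed.

Lemma tle_lt_trans s t u : tle s t -> tlt t u -> tlt s u.
Proof. by case: u => C h st [c tc]; exists c; exact: tle_trans st tc. Qed.

Lemma tltxx s : ~ tlt s s.
Proof.
elim: s => A f IH [a fa]; apply: (IH a); move: fa.
case E : (f a) => [C h] /(_ a) [c]; rewrite E => ac.
by exists c.
Qed.

Definition teq (s t : tree) : bool := `[< tle s t /\ tle t s >].

HB.instance Definition _ := gen_eqMixin tree.
HB.instance Definition _ := gen_choiceMixin tree.

Lemma teq_refl : reflexive teq.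
Proof. by move=> s; apply/asboolP; split; exact: tle_refl. Qed.

Lemma teq_sym : symmetric teq.
Proof. by move=> s t; apply/asboolP/asboolP => -[]. Qed.

Lemma teq_trans : transitive teq.
Proof.
move=> t s u /asboolP[st ts] /asboolP[tu ut].
by apply/asboolP; split; [exact: tle_trans st tu|exact: tle_trans ut ts].
Qed.

Canonical teq_equiv := EquivRel teq teq_refl teq_sym teq_trans.

Definition Ord : Type := {eq_quot teq_equiv}%qT.

HB.instance Definition _ := Choice.on Ord.
HB.instance Definition _ := EqQuotient.on Ord.

Definition ord_of (t : tree) : Ord := (\pi_Ord t)%qT.

Definition ord_le (x y : Ord) : bool := `[< tle (repr x) (repr y) >].

Lemma ord_of_repr (x : Ord) : ord_of (repr x) = x.
Proof. exact: reprK. Qed.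

Lemma repr_ord_of t : tle (repr (ord_of t)) t /\ tle t (repr (ord_of t)).
Proof.
have /eqmodP/asboolP// : (repr (ord_of t) = t %[mod Ord])%qT by rewrite reprK.
Qed.

Lemma ord_le_of s t : ord_le (ord_of s) (ord_of t) <-> tle s t.
Proof.
have [s1 s2] := repr_ord_of s; have [t1 t2] := repr_ord_of t.
split=> [/asboolP st|st]; last apply/asboolP.
  exact: tle_trans s2 (tle_trans st t1).
exact: tle_trans s1 (tle_trans st t2).
Qed.

Lemma ord_le_refl : reflexive ord_le.
Proof. by move=> x; apply/asboolP; exact: tle_refl. Qed.

Lemma ord_le_anti : antisymmetric ord_le.
Proof.
move=> x y /andP[/asboolP xy /asboolP yx].
rewrite -(ord_of_repr x) -(ord_of_repr y); apply/eqmodP; exact/asboolP.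
Qed.

Lemma ord_le_trans : transitive ord_le.
Proof. by move=> y x z /asboolP xy /asboolP yz; apply/asboolP; exact: tle_trans yz. Qed.

Lemma ord_le_total : total ord_le.
Proof.
move=> x y; have [xy|yx] := tle_or_tlt (repr x) (repr y); apply/orP.
  by left; apply/asboolP.
by right; apply/asboolP; exact: tlt_le.
Qed.

Fact ord_display : Order.disp_t. Proof. exact: (Order.Disp tt tt). Qed.

HB.instance Definition _ :=
  Order.Le_isPOrder.Build ord_display Ord ord_le_refl ord_le_anti ord_le_trans.
HB.instance Definition _ := Order.POrder_isTotal.Build ord_display Ord ord_le_total.

Lemma leE_of s t : (ord_of s <= ord_of t) <-> tle s t.
Proof. exact: ord_le_of. Qed.

Lemma ltE_of s t : (ord_of s < ord_of t) <-> tlt s t.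
Proof.
rewrite ltNge; split=> [/negP|st]; last first.
  by apply/negP => /leE_of ts; exact: (@tltxx t) (tle_lt_trans ts st).
by case: (tle_or_tlt t s) => // /leE_of ->.
Qed.

Lemma ord_wf : well_founded (fun x y : Ord => x < y).
Proof.
suff wf t : forall x, x <= ord_of t -> Acc (fun x y : Ord => x < y) x.
  by move=> x; apply: (wf (repr x)); rewrite ord_of_repr.
elim: t => A f IH x xt; constructor=> y /lt_le_trans/(_ xt).
rewrite -(ord_of_repr y) => /ltE_of[a ya].
by apply: (IH a); apply/leE_of.
Qed.

Lemma ord_bounded (A : Type) (f : A -> Ord) : exists y, forall a, f a < y.
Proof.
exists (ord_of (node (fun a => repr (f a)))) => a.
by rewrite -{1}(ord_of_repr (f a)); apply/ltE_of; exists a; exact: tle_refl.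
Qed.

Fixpoint tbelow (t : tree) : Type :=
  let: node A f := t in {a : A & option (tbelow (f a))}.

Lemma tbelow_surj t :
  exists g : tbelow t -> Ord, forall x, x < ord_of t -> exists a, x = g a.
Proof.
elim: t => A f IH /=.
pose g a := projT1 (cid (IH a)); have gP a := projT2 (cid (IH a)).
exists (fun p => if projT2 p is Some b then g (projT1 p) b else ord_of (f (projT1 p))).
move=> x; rewrite -{1}(ord_of_repr x) => /ltE_of[a].
move=> /leE_of; rewrite ord_of_repr le_eqVlt => /predU1P[->|/(gP a)[b ->]].
  by exists (existT _ a None).
by exists (existT _ a (Some b)).
Qed.

Lemma below_bounded (x : Ord) (f : Ord -> Ord) :
  has_ubound (f @` [set y | y < x]).
Proof.
have [g gP] := tbelow_surj (repr x); rewrite ord_of_repr in gP.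
have [z zP] := ord_bounded (fun a => f (g a)).
by exists z => _ [y /gP[a ->] <-]; apply/ltW/zP.
Qed.

Lemma ord_min (P : set Ord) : P !=set0 ->
  exists2 x, P x & forall y, P y -> x <= y.
Proof.
move=> [x]; elim/(well_founded_ind ord_wf): x => x IH Px.
have [[y Py yx]|nP] := pselect (exists2 y, P y & y < x); first exact: (IH y).
exists x => // y Py; rewrite leNgt; apply/negP => yx; apply: nP; by exists y.
Qed.

Lemma has_supremums (A : set Ord) : has_ubound A -> exists x, supremums A x.
Proof. by case/ord_min => x ubx minx; exists x. Qed.

(** ** Arithmetic

    By [ord_bounded] and [below_bounded] every nonempty set whose supremum is taken
    below is bounded, so the default value of [supremum] serves only [set0]. *)

Definition ozero : Ord := ord_of (node (fun i : False => match i return tree with end)).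

Definition osucc (x : Ord) : Ord := ord_of (node (fun _ : unit => repr x)).

Lemma ozero_le x : ozero <= x.
Proof. by rewrite -(ord_of_repr x); apply/leE_of; case: (repr x) => A f []. Qed.

Lemma lt_osucc x y : (x < osucc y) = (x <= y).
Proof.
have -> : (x <= y) = (ord_of (repr x) <= ord_of (repr y)) by rewrite !ord_of_repr.
rewrite -[in LHS](ord_of_repr x); apply/idP/idP => [/ltE_of[_ xy]|/leE_of xy].
  exact/leE_of.
by apply/ltE_of; exists tt.
Qed.

Definition osup (A : set Ord) : Ord := supremum ozero A.

Lemma osup_le (A : set Ord) y : has_ubound A ->
  (osup A <= y) <-> (forall x, A x -> x <= y).
Proof.
move=> /has_supremums[x xA]; rewrite /osup /supremum.
case: ifPn => [/eqP -> //|/set0P[a Aa]]; first by split=> // _; exact: ozero_le.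
case: xgetP => [z -> [ubz lbz]|/(_ x)//]; split=> [zy u /ubz uz|]; last exact: lbz.
exact: le_trans uz zy.
Qed.

Definition is_limit (x : Ord) : Prop := x != ozero /\ ~ exists y, x = osucc y.

Section recursion.
Variables (T : Type) (z : T) (s : T -> T) (l : set T -> T).

Let step (x : Ord) (rec : forall y : Ord, y < x -> T) : T :=
  if pselect (exists2 y, x = osucc y & y < x) is left h
  then s (rec (s2val (cid2 h)) (s2valP' (cid2 h)))
  else if x == ozero then z
  else l [set t | exists y, exists h : y < x, t = rec y h].

(** Value [z] at zero, [s] applied at successors, and [l] applied to the set of
    all earlier values at limits. *)
Definition orec : Ord -> T := Fix ord_wf (fun _ => T) step.

Lemma orecE x : orec x = step (fun y (_ : y < x) => orec y).
Proof.
rewrite /orec Fix_eq// => {}x f g fg; congr step.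
by apply/functional_extensionality_dep => y; apply/functional_extensionality_dep.
Qed.

Lemma orec0 : orec ozero = z.
Proof.
rewrite orecE /step; case: pselect => [h|_]; last by rewrite eqxx.
by have [y _] := h; rewrite ltNge ozero_le.
Qed.

Lemma orecS x : orec (osucc x) = s (orec x).
Proof.
rewrite orecE /step; case: pselect => [h|[]]; last by exists x; rewrite ?lt_osucc.
case: (cid2 h) => y /= xy _; congr (s (orec _)).
by apply/le_anti; rewrite -lt_osucc xy lt_osucc lexx -lt_osucc -xy lt_osucc lexx.
Qed.

Lemma orecL x : is_limit x -> orec x = l (orec @` [set y | y < x]).
Proof.
move=> [/negbTE x0 nS]; rewrite orecE /step x0.
case: pselect => [h|_]; first by have [y xy _] := h; case: nS; exists y.
congr l; apply/seteqP; split=> t /=; first by move=> [y [yx ->]]; exists y.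
by move=> [y yx <-]; exists y, yx.
Qed.

End recursion.

Definition oadd (x : Ord) : Ord -> Ord := orec x osucc osup.

Definition omul (x : Ord) : Ord -> Ord := orec ozero (fun t => oadd t x) osup.

Definition omega : Ord := osup (range (fun k => iter k osucc ozero)).

Definition omega_pow : Ord -> Ord := orec (osucc ozero) (fun t => omul t omega) osup.

Definition omega_tower (k : nat) : Ord := iter k omega_pow (osucc ozero).

Definition epsilon0 : Ord := osup (range omega_tower).

(** The [d] with [a + d = x] when [a <= x]. *)
Definition osub (x a : Ord) : Ord := xget ozero [set d | oadd a d = x].

Definition ell (x : Ord) : Ord :=
  if x == ozero then ozero
  else xget ozero [set b | exists c, x = oadd c (omega_pow b)].

(** ** Transfinite words *)

Definition Below (x : Ord) : Type := {y : Ord | y < x}.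

HB.instance Definition _ x := Choice.on (Below x).

Record word : Type := Word { wlen : Ord; wletter : Below wlen -> bool }.

Definition mkword (x : Ord) (f : Ord -> bool) : word :=
  @Word x (fun y => f (val y)).

(** The letter at an arbitrary position, [false] beyond the length. *)
Definition wat (A : word) (y : Ord) : bool :=
  oapp (@wletter A) false (insub y).

Definition wempty : word := mkword ozero (fun _ => false).

Definition wcat (A B : word) : word :=
  mkword (oadd (wlen A) (wlen B))
    (fun y => if y < wlen A then wat A y else wat B (osub y (wlen A))).

(** For words extending one another, the least common extension. *)
Definition wunion (S : set word) : word :=
  mkword (osup (@wlen @` S)) (fun y => `[< exists2 A, S A & wat A y >]).

Definition wpow (A : word) : Ord -> word := orec wempty (fun W => wcat W A) wunion.

Definition periodic (X : word) : Prop :=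
  exists A x, [/\ wlen A != ozero, is_limit x & X = wpow A x].

Definition ultimately_periodic (X : word) : Prop :=
  exists B Y, periodic Y /\ X = wcat B Y.

Definition up_in (X : set Ord) (x : Ord) : Prop :=
  ultimately_periodic (mkword x (fun y => `[< X y >])).

Definition hereditarily_periodic (X : set Ord) (Omega : Ord) : Prop :=
  forall x, is_limit x -> x <= Omega -> up_in X x.

(** ** The families of sets

    A subset of [Omega] is a [set (Below Omega)]; [val @` X] is the same set
    seen as a set of ordinals. *)

Unset Implicit Arguments.

Definition ell_preimage {Omega : Ord} (A : set (Below Omega)) : set (Below Omega) :=
  [set x | (val @` A) (ell (val x))].

Definition H0 (Omega : Ord) : set (set (Below Omega)) :=
  [set X | hereditarily_periodic (val @` X) Omega].

Fixpoint Vfam (n : nat) (Omega : Ord) : set (set (Below Omega)) :=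
  if n is m.+1 then
    [set X | exists B A, [/\ H0 Omega B, Vfam m Omega A & X = B `&` ell_preimage A]]
  else H0 Omega.

(** [H0] is itself closed under finite unions, and the empty set is in every
    [Vfam n Omega], so that binary unions are enough. *)
Definition Hfam (n : nat) (Omega : Ord) : set (set (Below Omega)) :=
  if n is 0 then H0 Omega else smallest setU_closed (Vfam n Omega).

(** ** The topologies *)

Definition interval_subbase (Omega : Ord) : set (set (Below Omega)) :=
  [set U | U = [set x | val x = ozero] \/
           exists a b, [/\ a < b, b <= Omega & U = [set x | a < val x < b]]].

Definition ell_subbase (n : nat) (Omega : Ord) : set (set (Below Omega)) :=
  [set U | exists m b, (m <= n)%N /\ U = [set x | b < iter m ell (val x)]].

Definition theta (n : nat) (Omega : Ord) : Type := Below Omega.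

HB.instance Definition _ n Omega := Choice.on (theta n Omega).
(** For [n = 0] the sets of [ell_subbase] are end intervals, already open in the
    interval topology. *)
HB.instance Definition _ n Omega := isSubBaseTopological.Build (theta n Omega)
  (interval_subbase Omega `|` ell_subbase n Omega) id.

Definition derivative (Omega : Ord) (n : nat) (A : set (Below Omega)) :
    set (Below Omega) :=
  limit_point (A : set (theta n Omega)).

Set Implicit Arguments.

(** ** Polymodal provability logic *)

Inductive form : Type :=
| Var (p : nat)
| Bot
| Imp (f g : form)
| Box (n : nat) (f : form).

Definition Neg (f : form) : form := Imp f Bot.

Definition Dia (n : nat) (f : form) : form := Neg (Box n (Neg f)).

(** Variables and boxed formulas are the atoms. *)
Fixpoint bool_eval (h : form -> bool) (f : form) : bool :=
  match f with
  | Bot => false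
  | Imp g k => bool_eval h g ==> bool_eval h k
  | _ => h f
  end.

Definition tautology (f : form) : Prop := forall h, bool_eval h f.

Inductive GLP : form -> Prop :=
| GLP_taut f of tautology f : GLP f
| GLP_K n f g : GLP (Imp (Box n (Imp f g)) (Imp (Box n f) (Box n g)))
| GLP_Lob n f : GLP (Imp (Box n (Imp (Box n f) f)) (Box n f))
| GLP_neg m n f of (m < n)%N : GLP (Imp (Dia m f) (Box n (Dia m f)))
| GLP_mono m n f of (m <= n)%N : GLP (Imp (Box m f) (Box n f))
| GLP_mp f g of GLP (Imp f g) & GLP f : GLP g
| GLP_nec n f of GLP f : GLP (Box n f).

(** The formulas all of whose modalities are in [I]. *)
Fixpoint language (I : set nat) (f : form) : Prop :=
  match f with
  | Var _ | Bot => True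
  | Imp g k => language I g /\ language I k
  | Box n g => I n /\ language I g
  end.

Definition upto (n : nat) : set nat := [set i | (i <= n)%N].

Definition GLP_upto (n : nat) : set form := language (upto n) `&` GLP.

Fixpoint interp (X : Type) (d : nat -> set X -> set X) (v : nat -> set X) (f : form) :
    set X :=
  match f with
  | Var p => v p
  | Bot => set0
  | Imp g k => ~` interp d v g `|` interp d v k
  | Box n g => ~` d n (~` interp d v g)
  end.

(** The logic, in the language with modalities in [I], of the space [X] whose
    [i]-th topology has derivative operator [d i], for valuations in [A]. *)
Definition Log (X : Type) (I : set nat) (d : nat -> set X -> set X)
    (A : set (set X)) : set form :=
  [set f | language I f /\
           forall v : nat -> set X, (forall p, A (v p)) -> interp d v f = setT].

(* Main.v *)
From HB Require Import structures.
Require Import Defs.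
From mathcomp Require Import all_boot all_order.
From mathcomp Require Import finmap all_classical topology.

(** Soundness.  Only the axiom [<m>f -> [n]<m>f] needs the algebra.  That
    [d_m A] is open in the next topology for [A] in the algebra rests on periodicity:
    near a point whose rank [ell a] is a limit, a periodic set looks the same in all
    blocks of length [omega^s] (some [s < ell a]) that start at points of rank at least [s].
    Together with [d_{n+1} (ell^-1 A) = ell^-1 (d_n A)] this computes all derivatives.

    Completeness.  If [f] is not a theorem, it is missing from some state of the finite
    canonical frame, whose states are the maximal consistent subsets of an adequate set of
    formulas, with relations [R_0, ..., R_N].
    By downward induction on [k], and for fixed [k] by induction along
    [R_k, ..., R_N], each state [x] is the label of the last point [a] of a labelled
    interval, 0 excluded, in which boxes from [k] on, read in the topologies from [0] on,
    are true exactly where the labels say so.  For the step, let [f'] be the labelling up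
    to [a'] of the interval of [x] for [k+1], and let the word [w] of length [p] concatenate the
    intervals for [k] of all the states above [x].  Repeat [w] up to [p * omega^a'], and
    relabel each point [p * q] with [q] a limit by [f' (ell q)]: the repetitions of [w]
    provide the [R_k]-successors, and [ell] transports the truth of the higher boxes.
    Since [x] labels only the last point, all points below it satisfy what is boxed in
    [x]; here monotonicity of the boxes is used. *)

Set Implicit Arguments.
Unset Strict Implicit.
Unset Printing Implicit Defensive.

Import Order.TTheory.
Local Open Scope order_scope.
Local Open Scope classical_set_scope.

(** * Ordinal arithmetic *)

Local Notation "x +o y" := (oadd x y) (at level 50, left associativity).
Local Notation "x *o y" := (omul x y) (at level 40, left associativity).
Local Notation oone := (osucc ozero).

Lemma ltNge0 x : (x < ozero) = false.
Proof. by rewrite ltNge ozero_le. Qed.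

Lemma lt0_neq x : (ozero < x) = (x != ozero).
Proof. by rewrite lt_neqAle ozero_le andbT eq_sym. Qed.

Lemma osucc_le x y : (osucc x <= y) = (x < y).
Proof. by rewrite leNgt lt_osucc -ltNge. Qed.

Lemma ltSo x : x < osucc x.
Proof. by rewrite lt_osucc. Qed.

Lemma osucc_lt x y : (osucc x < osucc y) = (x < y).
Proof. by rewrite lt_osucc osucc_le. Qed.

Lemma osucc_neq0 x : osucc x != ozero.
Proof. by rewrite -lt0_neq lt_osucc ozero_le. Qed.

Lemma ord_case x : [\/ x = ozero, exists y, x = osucc y | is_limit x].
Proof.
have [->|x0] := eqVneq x ozero; first by constructor 1.
have [[y xy]|n] := pselect (exists y, x = osucc y); first by constructor 2; exists y.
by constructor 3.
Qed.

Lemma limit_succ x y : is_limit x -> y < x -> osucc y < x.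
Proof.
move=> [_ xS] yx; rewrite lt_neqAle osucc_le yx andbT.
by apply/eqP => xy; apply: xS; exists y.
Qed.

Lemma limit_gt0 x : is_limit x -> ozero < x.
Proof. by case; rewrite lt0_neq. Qed.

Lemma limitP x : ozero < x -> (forall y, y < x -> osucc y < x) -> is_limit x.
Proof.
rewrite lt0_neq => x0 xS; split=> // -[y xy]; have := xS y.
by rewrite xy ltSo ltxx => /(_ isT).
Qed.

Lemma osucc_nlimit x : ~ is_limit (osucc x).
Proof. by case=> _; apply; exists x. Qed.

Lemma lt_ind (P : Ord -> Prop) :
  (forall x, (forall y, y < x -> P y) -> P x) -> forall x, P x.
Proof. by move=> IH x; elim/(well_founded_ind ord_wf): x => x; exact: IH. Qed.

Lemma ord_ind3 (P : Ord -> Prop) :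
  P ozero -> (forall x, P x -> P (osucc x)) ->
  (forall x, is_limit x -> (forall y, y < x -> P y) -> P x) -> forall x, P x.
Proof.
move=> P0 PS PL; apply: lt_ind => x IH.
case: (ord_case x) => [->//|[y xy]|xL]; last exact: PL.
by rewrite xy; apply: PS; apply: IH; rewrite xy ltSo.
Qed.

Lemma supL_le (F : Ord -> Ord) x z :
  (osup (F @` [set y | y < x]) <= z) <-> (forall y, y < x -> F y <= z).
Proof.
rewrite osup_le; last exact: below_bounded.
by split=> [H y yx|H _ [y yx <-]]; [apply: H; exists y|apply: H].
Qed.

Lemma lt_supL (F : Ord -> Ord) x z :
  (z < osup (F @` [set y | y < x])) <-> (exists2 y, y < x & z < F y).
Proof.
rewrite ltNge; split=> [/negP H|[y yx zy]].
  apply: contrapT => nE; apply: H; apply/supL_le => y yx.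
  by rewrite leNgt; apply/negP => zy; apply: nE; exists y.
by apply/negP => /supL_le /(_ y yx); rewrite leNgt zy.
Qed.

Lemma oadd0 x : x +o ozero = x. Proof. exact: orec0. Qed.
Lemma oaddS x y : x +o osucc y = osucc (x +o y). Proof. exact: orecS. Qed.
Lemma oaddL_le x y z : is_limit y ->
  (x +o y <= z) <-> (forall u, u < y -> x +o u <= z).
Proof. by move=> yL; rewrite {1}/oadd orecL//; exact: supL_le. Qed.
Lemma lt_oaddL x y z : is_limit y ->
  (z < x +o y) <-> (exists2 u, u < y & z < x +o u).
Proof. by move=> yL; rewrite {1}/oadd orecL//; exact: lt_supL. Qed.

Lemma oadd_ltr x : {homo oadd x : y z / y < z}.
Proof.
move=> y z; elim/ord_ind3: z => [|z IH|z zL IH].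
- by rewrite ltNge0.
- rewrite lt_osucc oaddS lt_osucc le_eqVlt => /predU1P[->//|/IH]; exact: ltW.
- move=> yz; apply/lt_oaddL => //; exists (osucc y); first exact: limit_succ.
  by rewrite oaddS ltSo.
Qed.

Lemma oadd_lt x y z : (x +o y < x +o z) = (y < z).
Proof. exact/(leW_mono (le_mono (@oadd_ltr x))). Qed.
Lemma oadd_le x y z : (x +o y <= x +o z) = (y <= z).
Proof. exact/(le_mono (@oadd_ltr x)). Qed.
Lemma oaddI x : injective (oadd x).
Proof. by move=> y z /eqP; rewrite eq_le !oadd_le -eq_le => /eqP. Qed.

Lemma le_oaddr x y : x <= x +o y.
Proof. by rewrite -{1}(oadd0 x) oadd_le ozero_le. Qed.
Lemma lt_oaddr x y : ozero < y -> x < x +o y.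
Proof. by move=> y0; rewrite -{1}(oadd0 x) oadd_lt. Qed.

Lemma add0o y : ozero +o y = y.
Proof.
elim/ord_ind3: y => [|y IH|y yL IH]; first by rewrite oadd0.
  by rewrite oaddS IH.
apply/le_anti/andP; split; first by apply/oaddL_le => // u uy; rewrite IH// ltW.
rewrite leNgt; apply/negP => ly.
have := IH _ ly; have := @oadd_ltr ozero _ _ ly => /[swap] ->.
by rewrite ltxx.
Qed.

Lemma oadd_limit x y : is_limit y -> is_limit (x +o y).
Proof.
move=> yL; apply: limitP => [|z];
  first by apply: le_lt_trans (ozero_le x) _; rewrite lt_oaddr// limit_gt0.
move=> /lt_oaddL -/(_ yL)[u uy zu]; apply/lt_oaddL => //.
by exists (osucc u); [exact: limit_succ|rewrite oaddS osucc_lt].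
Qed.

Lemma oaddA x y z : x +o (y +o z) = x +o y +o z.
Proof.
elim/ord_ind3: z => [|z IH|z zL IH]; [by rewrite !oadd0|by rewrite !oaddS IH|].
apply/le_anti/andP; split.
  apply/oaddL_le; first exact: oadd_limit.
  move=> u /lt_oaddL -/(_ zL)[v vz uv].
  by apply: le_trans (ltW (oadd_ltr x uv)) _; rewrite IH// oadd_le ltW.
by apply/oaddL_le => // u uz; rewrite -IH// !oadd_le ltW.
Qed.

Lemma oadd_leL x y z : x <= y -> x +o z <= y +o z.
Proof.
move=> xy; elim/ord_ind3: z => [|z IH|z zL IH]; rewrite ?oadd0// ?oaddS.
  by rewrite osucc_le lt_osucc.
by apply/oaddL_le => // u uz; apply: le_trans (IH _ uz) _; rewrite oadd_le ltW.
Qed.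

Lemma le_oaddl x y : y <= x +o y.
Proof. by rewrite -{1}(add0o y) oadd_leL ?ozero_le. Qed.

Lemma oadd_leD x y x' y' : x <= x' -> y <= y' -> x +o y <= x' +o y'.
Proof. by move=> xx yy; apply: le_trans (oadd_leL _ xx) _; rewrite oadd_le. Qed.

Lemma osub_ex a x : a <= x -> exists d, x = a +o d.
Proof.
move=> ax; have : exists y, x < a +o y.
  by exists (osucc x); rewrite oaddS lt_osucc le_oaddl.
move=> /ord_min[d xd mind]; case: (ord_case d) => [d0|[e de]|dL].
- by move: xd; rewrite d0 oadd0 ltNge ax.
- exists e; apply/le_anti; rewrite -lt_osucc -oaddS -de xd /= leNgt.
  by apply/negP => /mind; rewrite de leNgt ltSo.
- move/lt_oaddL: xd => /(_ dL)[u ud /mind]; by rewrite leNgt ud.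
Qed.

Lemma osubK a d : osub (a +o d) a = d.
Proof. by apply: (@oaddI a); rewrite /osub; case: xgetP => [y _ //|/(_ d)/(_ erefl)]. Qed.

Lemma osub_lt0 a x : x < a -> osub x a = ozero.
Proof.
move=> xa; rewrite /osub; case: xgetP => // d _ /= dx.
by move: xa; rewrite -dx ltNge le_oaddr.
Qed.

Lemma limit_oadd x y : is_limit (x +o y) -> ozero < y -> is_limit y.
Proof.
move=> xyL y0; apply: limitP => // z zy.
by rewrite -(oadd_lt x) oaddS; apply: limit_succ; rewrite ?oadd_lt.
Qed.

Lemma leNgt0 x : (x <= ozero) = (x == ozero).
Proof. by rewrite leNgt lt0_neq negbK. Qed.

(** ** Multiplication *)

Lemma omul0 x : x *o ozero = ozero. Proof. exact: orec0. Qed.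
Lemma omulS x y : x *o osucc y = x *o y +o x. Proof. exact: orecS. Qed.
Lemma omulL_le x y z : is_limit y ->
  (x *o y <= z) <-> (forall u, u < y -> x *o u <= z).
Proof. by move=> yL; rewrite {1}/omul orecL//; exact: supL_le. Qed.
Lemma lt_omulL x y z : is_limit y ->
  (z < x *o y) <-> (exists2 u, u < y & z < x *o u).
Proof. by move=> yL; rewrite {1}/omul orecL//; exact: lt_supL. Qed.

Lemma mul0o y : ozero *o y = ozero.
Proof.
elim/ord_ind3: y => [|y IH|y yL IH]; [by rewrite omul0|by rewrite omulS IH oadd0|].
apply/eqP; rewrite -leNgt0; apply/omulL_le => // u uy; by rewrite IH.
Qed.

Lemma omul_ltr x : ozero < x -> {homo omul x : y z / y < z}.
Proof.
move=> x0 y z; elim/ord_ind3: z => [|z IH|z zL IH].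
- by rewrite ltNge0.
- rewrite lt_osucc omulS le_eqVlt => /predU1P[->|/IH]; first exact: lt_oaddr.
  by move=> /lt_le_trans; apply; exact: le_oaddr.
- move=> yz; apply/lt_omulL => //; exists (osucc y); first exact: limit_succ.
  by rewrite omulS lt_oaddr.
Qed.

Lemma omul_lt x y z : ozero < x -> (x *o y < x *o z) = (y < z).
Proof. by move=> x0; exact/(leW_mono (le_mono (@omul_ltr x x0))). Qed.
Lemma omul_le x y z : ozero < x -> (x *o y <= x *o z) = (y <= z).
Proof. by move=> x0; exact/(le_mono (@omul_ltr x x0)). Qed.

Lemma omul_leW x y z : y <= z -> x *o y <= x *o z.
Proof.
move=> yz; have [->|] := eqVneq x ozero; first by rewrite !mul0o.
by rewrite -lt0_neq => x0; rewrite omul_le.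
Qed.

Lemma omul_limit x y : ozero < x -> is_limit y -> is_limit (x *o y).
Proof.
move=> x0 yL; apply: limitP => [|z].
  by rewrite -(omul0 x) omul_lt// limit_gt0.
move=> /lt_omulL -/(_ yL)[u uy zu]; apply/lt_omulL => //.
exists (osucc u); first exact: limit_succ.
rewrite omulS (le_lt_trans _ (lt_oaddr _ x0))// osucc_le.
exact: zu.
Qed.

Lemma omulDr x y z : x *o (y +o z) = x *o y +o x *o z.
Proof.
have [->|] := eqVneq x ozero; first by rewrite !mul0o oadd0.
rewrite -lt0_neq => x0.
elim/ord_ind3: z => [|z IH|z zL IH].
- by rewrite omul0 !oadd0.
- by rewrite oaddS !omulS IH oaddA.
apply/le_anti/andP; split.
  apply/omulL_le; first exact: oadd_limit.
  move=> u /lt_oaddL -/(_ zL)[v vz uv].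
  apply: le_trans (ltW (omul_ltr x0 uv)) _; rewrite IH// oadd_le.
  by rewrite omul_le// ltW.
apply/oaddL_le; first exact: omul_limit.
move=> u /lt_omulL -/(_ zL)[v vz uv].
apply: le_trans (ltW (oadd_ltr _ uv)) _.
by rewrite -IH// omul_le// oadd_le ltW.
Qed.

Lemma omulA x y z : x *o (y *o z) = x *o y *o z.
Proof.
have [->|] := eqVneq x ozero; first by rewrite !mul0o.
have [->|] := eqVneq y ozero; first by rewrite omul0 !mul0o omul0.
rewrite -!lt0_neq => y0 x0.
have xy0 : ozero < x *o y by rewrite -(omul0 x) omul_lt.
elim/ord_ind3: z => [|z IH|z zL IH]; [by rewrite !omul0|by rewrite !omulS omulDr IH|].
apply/le_anti/andP; split.
  apply/omulL_le; first exact: omul_limit.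
  move=> u /lt_omulL -/(_ zL)[v vz uv].
  apply: le_trans (ltW (omul_ltr x0 uv)) _; rewrite IH//.
  by rewrite omul_le// ltW.
by apply/omulL_le => // u uz; rewrite -IH// !omul_le// ltW.
Qed.

Lemma omul1 x : x *o oone = x.
Proof. by rewrite omulS omul0 add0o. Qed.

Lemma oadd1 x : x +o oone = osucc x.
Proof. by rewrite oaddS oadd0. Qed.

Lemma omul_leL x y z : x <= y -> x *o z <= y *o z.
Proof.
move=> xy; elim/ord_ind3: z => [|z IH|z zL IH]; rewrite ?omul0// ?omulS.
  exact: oadd_leD.
by apply/omulL_le => // u uz; apply: le_trans (IH _ uz) _; rewrite omul_leW// ltW.
Qed.

Lemma mul1o x : oone *o x = x.
Proof.
elim/ord_ind3: x => [|x IH|x xL IH]; [by rewrite omul0|by rewrite omulS IH oadd1|].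
apply/le_anti/andP; split; first by apply/omulL_le => // u ux; rewrite IH// ltW.
rewrite leNgt; apply/negP => ly.
have := IH _ ly; have := omul_ltr (ltSo ozero) ly => /[swap] ->.
by rewrite ltxx.
Qed.

Lemma omul_gt0 x y : ozero < x -> ozero < y -> ozero < x *o y.
Proof. by move=> x0 y0; rewrite -(omul0 x) omul_lt. Qed.

Lemma le_omull x y : ozero < x -> y <= x *o y.
Proof. by move=> x0; rewrite -{1}(mul1o y) omul_leL// osucc_le. Qed.

Lemma odiv_ex x b : ozero < x -> exists q r, b = x *o q +o r /\ r < x.
Proof.
move=> x0; have : exists y, b < x *o y.
  by exists (osucc b); rewrite (lt_le_trans (ltSo b))// le_omull.
move=> /ord_min[d bd mind]; case: (ord_case d) => [d0|[e de]|dL].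
- by move: bd; rewrite d0 omul0 ltNge0.
- have xeb : x *o e <= b.
    by rewrite leNgt; apply/negP => /mind; rewrite de leNgt ltSo.
  have [r br] := osub_ex xeb; exists e, r; split=> //.
  by move: bd; rewrite de br omulS oadd_lt.
- by move/lt_omulL: bd => /(_ dL)[u ud /mind]; rewrite leNgt ud.
Qed.

Lemma odiv_lt x q q' r r' : r < x -> q < q' -> x *o q +o r < x *o q' +o r'.
Proof.
move=> rx qq; apply: (@lt_le_trans _ _ (x *o osucc q)); first by rewrite omulS oadd_lt.
by apply: le_trans (le_oaddr _ _); rewrite omul_leW// osucc_le.
Qed.

Lemma odiv_uniq x q q' r r' : r < x -> r' < x ->
  x *o q +o r = x *o q' +o r' -> q = q' /\ r = r'.
Proof.
move=> rx r'x e; have [qq|qq|qq] := ltgtP q q'.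
- by have := odiv_lt r' rx qq; rewrite e ltxx.
- by have := odiv_lt r r'x qq; rewrite e ltxx.
- by split=> //; move: e; rewrite qq => /oaddI.
Qed.

(** ** Powers of [omega] *)

Definition onat (k : nat) : Ord := iter k osucc ozero.

Lemma range_ubound (F : nat -> Ord) : has_ubound (range F).
Proof. by have [z zP] := ord_bounded F; exists z => _ [k _ <-]; exact/ltW. Qed.

Lemma lt_sup_range (F : nat -> Ord) z : (z < osup (range F)) <-> (exists k, z < F k).
Proof.
have FP y := osup_le y (range_ubound F).
rewrite ltNge; split=> [/negP H|[k zk]].
  apply: contrapT => nE; apply: H; apply/FP => _ [k _ <-].
  by rewrite leNgt; apply/negP => zk; apply: nE; exists k.
by apply/negP => /FP /(_ (F k)) -/(_ (ex_intro2 _ _ k I erefl)); rewrite leNgt zk.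
Qed.

Lemma lt_omega z : (z < omega) <-> (exists k, z = onat k).
Proof.
rewrite lt_sup_range; split=> [[k]|[k ->]]; last by exists k.+1; exact: ltSo.
elim: k z => [|k IH] z; first by rewrite /= ltNge0.
by rewrite lt_osucc le_eqVlt => /predU1P[->|/IH//]; exists k.
Qed.

Lemma onat_lt k : onat k < omega.
Proof. by apply/lt_omega; exists k. Qed.

Lemma omega_limit : is_limit omega.
Proof.
apply: limitP => [|y /lt_omega[k ->]]; first exact: (onat_lt 0).
exact: (onat_lt k.+1).
Qed.

Lemma omega_gt0 : ozero < omega. Proof. exact: (onat_lt 0). Qed.

Lemma onatD k j : onat k +o onat j = onat (j + k).
Proof. by elim: j => [|j IH]; rewrite ?oadd0// oaddS IH. Qed.

Lemma onatM k j : onat k *o onat j = onat (k * j).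
Proof.
elim: j => [|j IH]; first by rewrite omul0 muln0.
by rewrite omulS IH onatD mulnS.
Qed.

Lemma limit_omega x : is_limit x -> exists2 q, ozero < q & x = omega *o q.
Proof.
move=> xL; have [q [r [xqr /lt_omega[[|k] rk]]]] := odiv_ex x omega_gt0.
  rewrite rk oadd0 in xqr; exists q => //; rewrite lt0_neq.
  by apply/eqP => q0; move: (limit_gt0 xL); rewrite xqr q0 omul0 ltxx.
by case: xL => _ []; exists (omega *o q +o onat k); rewrite xqr rk oaddS.
Qed.

Lemma onat_omega k : onat k +o omega = omega.
Proof.
apply/le_anti; rewrite le_oaddl andbT; apply/oaddL_le; first exact: omega_limit.
by move=> u /lt_omega[j ->]; rewrite onatD ltW// onat_lt.
Qed.

Lemma onat_omegaM k : onat k.+1 *o omega = omega.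
Proof.
apply/le_anti/andP; split.
  apply/omulL_le; first exact: omega_limit.
  by move=> u /lt_omega[j ->]; rewrite onatM ltW// onat_lt.
by rewrite le_omull// lt0_neq osucc_neq0.
Qed.

Lemma onat_limit k x : is_limit x -> onat k +o x = x.
Proof.
move=> /limit_omega[q q0 ->]; have /osub_ex[q' ->] : oone <= q by rewrite osucc_le.
by rewrite omulDr omul1 oaddA onat_omega.
Qed.

Lemma one_limit x : is_limit x -> oone +o x = x.
Proof. exact: (onat_limit 1). Qed.

Lemma omega_pow0 : omega_pow ozero = oone. Proof. exact: orec0. Qed.
Lemma omega_powS x : omega_pow (osucc x) = omega_pow x *o omega.
Proof. exact: orecS. Qed.
Lemma omega_powL_le y z : is_limit y ->
  (omega_pow y <= z) <-> (forall u, u < y -> omega_pow u <= z).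
Proof. by move=> yL; rewrite {1}/omega_pow orecL//; exact: supL_le. Qed.
Lemma lt_omega_powL y z : is_limit y ->
  (z < omega_pow y) <-> (exists2 u, u < y & z < omega_pow u).
Proof. by move=> yL; rewrite {1}/omega_pow orecL//; exact: lt_supL. Qed.

Lemma omega_pow_gt0 x : ozero < omega_pow x.
Proof.
elim/ord_ind3: x => [|x IH|x xL IH]; first by rewrite omega_pow0 ltSo.
  by rewrite omega_powS omul_gt0 ?omega_gt0.
by apply/lt_omega_powL => //; exists ozero; [exact: limit_gt0|exact/IH/limit_gt0].
Qed.

Lemma omega_pow_ltS x : omega_pow x < omega_pow (osucc x).
Proof.
by rewrite omega_powS -{1}(omul1 (omega_pow x)) omul_lt ?omega_pow_gt0// (onat_lt 1).
Qed.

Lemma omega_pow_ltr : {homo omega_pow : y z / y < z}.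
Proof.
move=> y z; elim/ord_ind3: z => [|z IH|z zL IH].
- by rewrite ltNge0.
- rewrite lt_osucc le_eqVlt => /predU1P[->|/IH]; first exact: omega_pow_ltS.
  by move=> /lt_trans; apply; exact: omega_pow_ltS.
- move=> yz; apply/lt_omega_powL => //; exists (osucc y); first exact: limit_succ.
  exact: omega_pow_ltS.
Qed.

Lemma omega_pow_lt y z : (omega_pow y < omega_pow z) = (y < z).
Proof. exact/(leW_mono (le_mono omega_pow_ltr)). Qed.
Lemma omega_pow_le y z : (omega_pow y <= omega_pow z) = (y <= z).
Proof. exact/(le_mono omega_pow_ltr). Qed.

Lemma omega_pow_limit x : ozero < x -> is_limit (omega_pow x).
Proof.
case: (ord_case x) => [->|[y ->] _|xL _]; first by rewrite ltxx.
  by rewrite omega_powS; apply: omul_limit; [exact: omega_pow_gt0|exact: omega_limit].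
apply: limitP => [|y /lt_omega_powL -/(_ xL)[u ux yu]]; first exact: omega_pow_gt0.
by apply/lt_omega_powL => //; exists (osucc u); [exact: limit_succ|
  apply: le_lt_trans (omega_pow_ltS u); rewrite osucc_le].
Qed.

Lemma omega_powD x y : omega_pow (x +o y) = omega_pow x *o omega_pow y.
Proof.
elim/ord_ind3: y => [|y IH|y yL IH].
- by rewrite oadd0 omega_pow0 omul1.
- by rewrite oaddS !omega_powS IH omulA.
apply/le_anti/andP; split.
  apply/omega_powL_le; first exact: oadd_limit.
  move=> u /lt_oaddL -/(_ yL)[v vy uv].
  apply: le_trans (ltW (omega_pow_ltr uv)) _.
  by rewrite IH// omul_leW// omega_pow_le ltW.
apply/omulL_le; first by apply: omega_pow_limit; exact: limit_gt0.
move=> u /lt_omega_powL -/(_ yL)[v vy uv].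
apply: le_trans (omul_leW _ (ltW uv)) _.
by rewrite -IH// omega_pow_le oadd_le ltW.
Qed.

Lemma le_omega_pow x : x <= omega_pow x.
Proof.
elim/lt_ind: x => x IH; rewrite leNgt; apply/negP => xw.
by have := IH _ xw; rewrite leNgt omega_pow_lt xw.
Qed.

Lemma omega_log x : ozero < x ->
  exists a, omega_pow a <= x /\ x < omega_pow (osucc a).
Proof.
move=> x0; have : exists y, x < omega_pow y.
  by exists (osucc x); exact: le_lt_trans (le_omega_pow x) (omega_pow_ltS x).
move=> /ord_min[d xd mind]; case: (ord_case d) => [d0|[e de]|dL].
- by move: xd; rewrite d0 omega_pow0 lt_osucc leNgt x0.
- exists e; rewrite -de xd; split=> //.
  by rewrite leNgt; apply/negP => /mind; rewrite de leNgt ltSo.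
- by move/lt_omega_powL: xd => /(_ dL)[u ud /mind]; rewrite leNgt ud.
Qed.

Lemma omega_log_div a x : omega_pow a <= x -> x < omega_pow (osucc a) ->
  exists k r, x = omega_pow a *o onat k.+1 +o r /\ r < omega_pow a.
Proof.
move=> ax xa; have [q [r [xqr ra]]] := odiv_ex x (omega_pow_gt0 a).
have /lt_omega[[|k] qk] : q < omega.
  rewrite -(omul_lt _ _ (omega_pow_gt0 a)) -omega_powS.
  by apply: le_lt_trans xa; rewrite xqr le_oaddr.
  by move: ax; rewrite xqr qk omul0 add0o leNgt ra.
by exists k, r; rewrite -qk.
Qed.

Lemma omega_log_le a x : x < omega_pow (osucc a) ->
  exists k, x <= omega_pow a *o onat k.+1.
Proof.
rewrite omega_powS => /lt_omulL -/(_ omega_limit)[u /lt_omega[k ->] xk].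
by exists k; rewrite (le_trans (ltW xk))// omul_leW// ltW// ltSo.
Qed.

(** Bounding [x] by a finite multiple of some [omega_pow c] with [c < a] and factoring [omega_pow c]
    out of both terms leaves a finite ordinal in front of a limit. *)
Lemma absorb x a : x < omega_pow a -> x +o omega_pow a = omega_pow a.
Proof.
have [->|] := eqVneq x ozero; first by rewrite add0o.
rewrite -lt0_neq => /omega_log[c [cx xc]] xa.
have /osub_ex[e ae] : c <= a by rewrite ltW// -omega_pow_lt (le_lt_trans cx).
have e0 : ozero < e.
  rewrite lt0_neq; apply/eqP => e0; move: xa.
  by rewrite ae e0 oadd0 ltNge cx.
apply/le_anti; rewrite le_oaddl andbT.
have [k xk] := omega_log_le xc; apply: le_trans (oadd_leL _ xk) _.
by rewrite ae omega_powD -omulDr onat_limit//; exact: omega_pow_limit.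
Qed.

Lemma omega_pow_add_lt x y a : x < omega_pow a -> y < omega_pow a ->
  x +o y < omega_pow a.
Proof. by move=> xa ya; rewrite -(absorb xa) oadd_lt. Qed.

Lemma omulo_omega a x : omega_pow a <= x -> x < omega_pow (osucc a) ->
  x *o omega = omega_pow (osucc a).
Proof.
move=> ax xa; apply/le_anti/andP; split; last by rewrite omega_powS omul_leL.
have [k xk] := omega_log_le xa; apply: le_trans (omul_leL _ xk) _.
by rewrite -omulA onat_omegaM omega_powS.
Qed.

Lemma omulo_omega_pow a x e : omega_pow a <= x -> x < omega_pow (osucc a) ->
  ozero < e -> x *o omega_pow e = omega_pow (a +o e).
Proof.
move=> ax xa e0; have /osub_ex[e' ->] : oone <= e by rewrite osucc_le.
by rewrite !omega_powD omega_powS omega_pow0 mul1o !omulA (omulo_omega ax xa) omega_powS.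
Qed.

(** ** The function [ell] *)

(** The least nonzero final segment of [x] is a finite multiple of its leading power, since a
    nonzero remainder would be a smaller final segment. *)
Lemma cnf_last x : ozero < x -> exists c b, x = c +o omega_pow b.
Proof.
move=> x0; have : exists d, ozero < d /\ exists c, x = c +o d.
  by exists x; split=> //; exists ozero; rewrite add0o.
move=> /ord_min[d [d0 [c xcd]] mind].
have [b [bd db]] := omega_log d0; have [k [r [dkr rb]]] := omega_log_div bd db.
exists (c +o omega_pow b *o onat k), b.
rewrite xcd -oaddA -omulS; congr oadd.
suff r0 : r = ozero by rewrite dkr r0 oadd0.
apply/eqP/negPn; rewrite -lt0_neq; apply/negP => r0.
have : d <= r.
  by apply: mind; split=> //; exists (c +o omega_pow b *o onat k.+1); rewrite xcd dkr oaddA.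
by rewrite leNgt (lt_le_trans rb).
Qed.

Lemma cnf_uniq c b c' b' : c +o omega_pow b = c' +o omega_pow b' -> b = b'.
Proof.
wlog bb : c b c' b' / b <= b'.
  by move=> W; case/orP: (le_total b b') => bb e; [exact: W bb e|
    by rewrite (W _ _ _ _ bb (esym e))].
move=> e; apply/le_anti; rewrite bb /= leNgt; apply/negP => {}bb.
have [cc|cc] := leP c c'.
  have [f fE] := osub_ex cc; move: e; rewrite fE -oaddA => /oaddI e.
  by have := le_oaddl f (omega_pow b'); rewrite -e leNgt omega_pow_lt bb.
have [f fE] := osub_ex (ltW cc); move: e; rewrite fE -oaddA => /oaddI e.
have fb : f < omega_pow b' by rewrite -e lt_oaddr ?omega_pow_gt0.
have := omega_pow_ltr bb => /(omega_pow_add_lt fb); by rewrite e ltxx.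
Qed.

Lemma ell_add c b : ell (c +o omega_pow b) = b.
Proof.
rewrite /ell; case: eqVneq => [e|_].
  by have := lt_le_trans (omega_pow_gt0 b) (le_oaddl c _); rewrite e ltxx.
by case: xgetP => [d _ [c' /cnf_uniq]//|/(_ b)[]]; exists c.
Qed.

Lemma ell_pow b : ell (omega_pow b) = b.
Proof. by rewrite -(add0o (omega_pow b)) ell_add. Qed.

Lemma ell0 : ell ozero = ozero. Proof. by rewrite /ell eqxx. Qed.

Lemma ell_cnf x : ozero < x -> exists c, x = c +o omega_pow (ell x).
Proof. by move=> /cnf_last[c [b ->]]; exists c; rewrite ell_add. Qed.

Lemma ellD c r : ozero < r -> ell (c +o r) = ell r.
Proof. by move=> /ell_cnf[d rE]; rewrite {1}rE oaddA ell_add. Qed.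

Lemma omega_pow_ell x : ozero < x -> omega_pow (ell x) <= x.
Proof. by move=> /ell_cnf[d {2}->]; exact: le_oaddl. Qed.

Lemma ell_le x : ell x <= x.
Proof.
have [->|] := eqVneq x ozero; first by rewrite ell0.
rewrite -lt0_neq => /omega_pow_ell; apply: le_trans; exact: le_omega_pow.
Qed.

Lemma ell_lt_pow x b : ozero < x -> x < omega_pow b -> ell x < b.
Proof. by move=> x0 xb; rewrite -omega_pow_lt (le_lt_trans (omega_pow_ell x0)). Qed.

Lemma ell_near x : ozero < x -> exists2 c, c < x & forall y, c < y < x -> ell y < ell x.
Proof.
move=> x0; have [c xE] := ell_cnf x0; exists c.
  by rewrite xE lt_oaddr// omega_pow_gt0.
move=> y /andP[/[dup] cy /ltW/osub_ex[d yE]].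
rewrite xE yE oadd_lt ell_add => dx; rewrite yE -{1}(oadd0 c) oadd_lt in cy.
by rewrite ellD// ell_lt_pow.
Qed.

(** Past some prefix, [x] is a power of omega of exponent [ell x]; adding [omega_pow e] to a point
    there stays below [x] by additive indecomposability. *)
Lemma ell_cofinal x e c : e < ell x -> c < x ->
  exists2 y, c < y < x & ell y = e.
Proof.
move=> ex cx; have x0 := le_lt_trans (ozero_le _) cx.
have [g xE] := ell_cnf x0; wlog gc : c cx / g <= c.
  move=> W; case/orP: (le_total g c) => [|cg]; first exact: W.
  have gx : g < x by rewrite xE lt_oaddr// omega_pow_gt0.
  by have [y /andP[gy yx] ye] := W _ gx (lexx _); exists y; rewrite // yx (le_lt_trans cg).
have [d cE] := osub_ex gc; rewrite cE in cx *.
exists (g +o (d +o omega_pow e)); last by rewrite oaddA ell_add.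
rewrite oadd_lt lt_oaddr ?omega_pow_gt0//= xE oadd_lt.
by apply: omega_pow_add_lt; rewrite ?omega_pow_lt// -(oadd_lt g) -xE.
Qed.

(** In front of a power of omega with positive exponent, [p] acts as its leading power. This tells
    how stretching by [p] moves ranks in the model construction. *)
Lemma ell_mul_limit a p x : omega_pow a <= p -> p < omega_pow (osucc a) ->
  is_limit x -> ell (p *o x) = a +o ell x.
Proof.
move=> ap pa xL; have [c xE] := ell_cnf (limit_gt0 xL).
have e0 : ozero < ell x.
  rewrite lt0_neq; apply/eqP => e0; apply: (@osucc_nlimit c).
  by rewrite -oadd1 -omega_pow0 -e0 -xE.
by rewrite {1}xE omulDr (omulo_omega_pow ap pa)// ell_add.
Qed.

Lemma limit_ell x : is_limit x <-> ozero < ell x.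
Proof.
split=> [xL|l0].
  have [c xE] := ell_cnf (limit_gt0 xL); rewrite lt0_neq; apply/eqP => e0.
  by apply: (@osucc_nlimit c); rewrite -oadd1 -omega_pow0 -e0 -xE.
have x0 : ozero < x by exact: lt_le_trans l0 (ell_le x).
by have [c ->] := ell_cnf x0; apply/oadd_limit/omega_pow_limit.
Qed.

Lemma ell_omega_powM s k : ozero < k -> ell (omega_pow s *o k) = s +o ell k.
Proof. by move=> /ell_cnf[c {1}->]; rewrite omulDr -omega_powD ell_add. Qed.

Lemma ell_ge_mul s x : ozero < x -> s <= ell x -> exists2 k, ozero < k & x = omega_pow s *o k.
Proof.
move=> x0 sx; have [c xE] := ell_cnf x0; have [e eE] := osub_ex sx.
have [q [r [cE rs]]] := odiv_ex c (omega_pow_gt0 s).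
exists (q +o omega_pow e).
  exact: lt_le_trans (omega_pow_gt0 e) (le_oaddl _ _).
rewrite xE cE -oaddA absorb; last by rewrite (lt_le_trans rs)// omega_pow_le.
by rewrite eE omega_powD -omulDr.
Qed.

Lemma omega_tower_limit k : is_limit (omega_tower k.+1).
Proof.
apply: omega_pow_limit; case: k => [|k]; first exact: ltSo.
exact: omega_pow_gt0.
Qed.

Lemma omega_tower_add k x y : x < omega_tower k -> y < omega_tower k ->
  x +o y < omega_tower k.
Proof.
case: k => [|k]; last exact: omega_pow_add_lt.
by rewrite /= -omega_pow0; exact: omega_pow_add_lt.
Qed.

(** Both factors are below powers whose exponents lie below the preceding tower, which is closed
    under addition. *)
Lemma omega_tower_mul k x y : x < omega_tower k.+2 -> y < omega_tower k.+2 ->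
  x *o y < omega_tower k.+2.
Proof.
have L := omega_tower_limit k.
move=> /lt_omega_powL -/(_ L)[u uk xu] /lt_omega_powL -/(_ L)[v vk yv].
apply: le_lt_trans (omul_leL _ (ltW xu)) _; apply: le_lt_trans (omul_leW _ (ltW yv)) _.
by rewrite -omega_powD; apply: omega_pow_ltr; exact: (@omega_tower_add k.+1).
Qed.

Lemma omega_tower_epsilon0 k : omega_tower k <= epsilon0.
Proof.
apply: ltW; apply/lt_sup_range; exists k.+1; elim: k => [|k IH]; last exact: omega_pow_ltr.
by rewrite /= -{1}omega_pow0 omega_pow_lt ltSo.
Qed.

(** * The topologies *)

Inductive cyl (n : nat) : set Ord -> Prop :=
| cylT : cyl n setT
| cyl_gt m b of (m <= n)%N : cyl n [set x | b < iter m ell x]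
| cylI A B of cyl n A & cyl n B : cyl n (A `&` B).

(* [pn n a U]: [U] contains a punctured neighbourhood of [a] in the [n]-th topology.
   Only lower bounds occur in [cyl], the upper bound being the point [a] itself. *)
Definition pn (n : nat) (a : Ord) (U : set Ord) : Prop :=
  exists O, [/\ cyl n O, O a & forall b, b < a -> O b -> U b].

Lemma cyl_mono m n O : (m <= n)%N -> cyl m O -> cyl n O.
Proof.
move=> mn; elim=> [|k b km|A B _ cA _ cB]; first exact: cylT.
  by apply: cyl_gt; exact: leq_trans mn.
exact: cylI.
Qed.

Lemma pn_mono m n a U : (m <= n)%N -> pn m a U -> pn n a U.
Proof. by move=> mn [O [cO Oa OU]]; exists O; split=> //; exact: cyl_mono cO. Qed.

Lemma pnW n a (U V : set Ord) : (forall b, b < a -> U b -> V b) -> pn n a U -> pn n a V.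
Proof.
move=> UV [O [cO Oa OU]]; exists O; split=> // b ba Ob; exact/UV/OU.
Qed.

Lemma pnT n a (U : set Ord) : (forall b, b < a -> U b) -> pn n a U.
Proof. by move=> UV; exists setT; split=> //; [exact: cylT|move=> b /UV]. Qed.

Lemma pnI n a (U V : set Ord) : pn n a U -> pn n a V -> pn n a (U `&` V).
Proof.
move=> [O [cO Oa OU]] [P [cP Pa PV]]; exists (O `&` P); split=> //; first exact: cylI.
by move=> b ba [Ob Pb]; split; [exact: OU|exact: PV].
Qed.

Lemma pn_cyl n O a : cyl n O -> O a -> pn n a O.
Proof. by exists O. Qed.

Lemma pn0P a U : pn 0 a U <->
  (a != ozero -> exists2 g, g < a & forall b, g < b < a -> U b).
Proof.
split=> [[O [cO Oa OU]]|H].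
  rewrite -lt0_neq => a0.
  suff [g ga gO] : exists2 g, g < a & forall b, g < b -> O b.
    by exists g => // b /andP[gb ba]; apply: OU => //; exact: gO.
  elim: cO Oa {OU} => [_|m b|A B _ IHA _ IHB]; first by exists ozero.
    by rewrite leqn0 => /eqP -> /= ba; exists b.
  move=> [/IHA[g ga gA] /IHB[h ha hB]]; exists (Order.max g h).
    by rewrite gt_max ga.
  by move=> b; rewrite gt_max => /andP[gb hb]; split; [exact: gA|exact: hB].
have [->|/H[g ga gU]] := eqVneq a ozero; first by apply: pnT => b; rewrite ltNge0.
exists [set x | g < iter 0 ell x]; split=> //; first exact: cyl_gt.
by move=> b ba gb; apply: gU; rewrite ba andbT.
Qed.

(** A subbasic condition on [iter m.+1 ell] at a point is the condition on [iter m ell] at its rank;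
    the case [m = 0] only contributes an interval. This recursion underlies the identity between
    [d_{n+1}] of an [ell]-preimage and the [ell]-preimage of [d_n]. *)
Lemma pnSP n a U : pn n.+1 a U <->
  exists V, pn n (ell a) V /\
   (a != ozero -> exists2 g, g < a & forall b, g < b < a -> V (ell b) -> U b).
Proof.
split=> [[O [cO Oa OU]]|[V [[P [cP Pa PV]] H]]].
  suff [V [cV Va gO]] : exists V, [/\ cyl n V, V (ell a) &
      a != ozero -> exists2 g, g < a & forall b, g < b -> V (ell b) -> O b].
    exists V; split; first exact: pn_cyl.
    move=> /gO[g ga {}gO]; exists g => // b /andP[gb ba] Vb.
    by apply: OU => //; exact: gO.
  elim: cO Oa {OU} => [_|[|m] b|A B _ IHA _ IHB].
  - by exists setT; split=> //; [exact: cylT|rewrite -lt0_neq => a0; exists ozero].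
  - move=> _ /= ba; exists setT; split=> //; [exact: cylT|by exists b].
  - rewrite ltnS => mn ba; exists [set x | b < iter m ell x].
    rewrite /= -iterSr; split=> //; first exact: cyl_gt.
    by rewrite -lt0_neq => a0; exists ozero => // c _ /=; rewrite -iterSr.
  - move=> [/IHA[V [cV Va gV]] /IHB[W [cW Wa gW]]].
    exists (V `&` W); split=> //; first exact: cylI.
    move=> a0; have [g ga {}gV] := gV a0; have [h ha {}gW] := gW a0.
    exists (Order.max g h); first by rewrite gt_max ga.
    move=> b; rewrite gt_max => /andP[gb hb] [Vb Wb].
    by split; [exact: gV|exact: gW].
have [->|a0] := eqVneq a ozero; first by apply: pnT => b; rewrite ltNge0.
have [g ga gU] := H a0.
(* [P] is inside [V] only below [ell a], so the interval is shrunk until all ranks in it are smaller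
   than [ell a]. *)
have [h ha near] : exists2 h, h < a & forall b, h < b < a -> ell b < ell a.
  by apply: ell_near; rewrite lt0_neq.
exists ([set x | Order.max g h < iter 0 ell x] `&` [set x | P (ell x)]); split.
- apply: cylI; first exact: cyl_gt.
  elim: cP {Pa PV} => [|m b mn|A B _ cA _ cB]; first exact: cylT.
    suff -> : [set x | [set y | b < iter m ell y] (ell x)] = [set x | b < iter m.+1 ell x].
      exact: cyl_gt.
    by apply/funext => x /=; rewrite -iterSr.
  exact: cylI cA cB.
- by split=> //=; rewrite gt_max ga.
- move=> b ba [/=]; rewrite gt_max => /andP[gb hb] Pb.
  by apply: gU; [rewrite gb|apply: PV => //; apply: near; rewrite hb].
Qed.

(** Translation by [g] preserves the rank of every nonzero ordinal, and an interval ending at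
    [g +o r] can be cut off at [g]. *)
Lemma pnD n g r U : ozero < r -> pn n (g +o r) U <-> pn n r (fun x => U (g +o x)).
Proof.
have H W r' : ozero < r' ->
    (exists2 h, h < g +o r' & forall b, h < b < g +o r' -> W b) <->
    (exists2 h, h < r' & forall b, h < b < r' -> W (g +o b)).
  move=> r0; split=> [[h hr hW]|[h hr hW]].
    have [hg|gh] := leP h g.
      exists ozero => // b /andP[b0 br]; apply: hW.
      by rewrite oadd_lt br andbT (le_lt_trans hg)// lt_oaddr.
    have [h' hE] := osub_ex (ltW gh); rewrite hE oadd_lt in hr.
    by exists h' => // b bh; apply: hW; rewrite hE !oadd_lt.
  exists (g +o h); first by rewrite oadd_lt.
  move=> b /andP[hb]; have [b' bE] := osub_ex (le_trans (le_oaddr g h) (ltW hb)).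
  by rewrite bE !oadd_lt in hb * => br; apply: hW; rewrite hb.
move=> r0; have gr0 : g +o r != ozero by rewrite -lt0_neq (lt_le_trans r0)// le_oaddl.
have rn0 : r != ozero by rewrite -lt0_neq.
case: n => [|n].
  rewrite !pn0P; split=> HU _; first exact/H/HU.
  exact/(H _ _ r0)/HU.
rewrite !pnSP ellD//; split=> -[V [pV HU]]; exists V; split=> // _.
  have [h hr hU] := (H (fun b => V (ell b) -> U b) _ r0).1 (HU gr0).
  exists h => // b /[dup] /andP[hb _] /hU; rewrite ellD//.
  exact: le_lt_trans (ozero_le _) hb.
apply/(H (fun b => V (ell b) -> U b) _ r0); have [h hr hU] := HU rn0.
exists h => // b /[dup] /andP[hb _] /hU; rewrite ellD//.
exact: le_lt_trans (ozero_le _) hb.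
Qed.

(** * Derivative operators in terms of punctured neighbourhoods *)

Section theta.
Variables (n : nat) (Omega : Ord).
Implicit Types (S U : set (theta n Omega)) (x : theta n Omega).

Let subbase := (interval_subbase Omega `|` ell_subbase n Omega).

Lemma theta_subbase_nbhs S x : subbase S -> S x -> nbhs x S.
Proof.
move=> sS Sx; rewrite nbhsE; exists S => //; split=> //.
exists [set S]; last by rewrite bigcup_set1.
by move=> _ ->; exact: finI_from1.
Qed.

Lemma theta_nbhs_fin U x : nbhs x U ->
  exists s : {fset set (theta n Omega)},
    [/\ {subset s <= subbase}, forall S, S \in s -> S x &
        forall y, (forall S, S \in s -> S y) -> U y].
Proof.
rewrite nbhsE => -[B [[D' D'sub <-] [C D'C Cx] BU]].
have [s ss sC] := D'sub _ D'C; rewrite /= in Cx.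
exists s; split=> //; first by move=> S Ss; move: Cx; rewrite -sC; exact.
by move=> y sy; apply: BU; exists C => //=; rewrite -sC => S; exact: sy.
Qed.

Lemma pn_subbase S x : subbase S -> S x ->
  pn n (\val x) (fun b => forall h : b < Omega, S (exist _ b h)).
Proof.
move=> [[->|[a [b [ab bO ->]]]]|[m [b [mn ->]]]] /=.
- by move=> ->; apply: pnT => b; rewrite ltNge0.
- move=> /andP[ax xb]; exists [set y | a < iter 0 ell y]; split=> //; first exact: cyl_gt.
  by move=> c cx ac h; rewrite /= ac/= (lt_trans cx).
- by move=> bx; exists [set y | b < iter m ell y]; split=> //; first exact: cyl_gt.
Qed.

Lemma cyl_nbhs O x : cyl n O -> O (\val x) -> nbhs x [set y : theta n Omega | O (\val y)].
Proof.
elim=> [_|m b mn bx|A B _ IHA _ IHB [Ax Bx]]; first exact: filterT.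
  by apply: theta_subbase_nbhs => //; right; exists m, b.
by apply: filterI; [exact: IHA|exact: IHB].
Qed.

Lemma derivativeP (A : set (Below Omega)) (x : Below Omega) :
  derivative Omega n A x <-> ~ pn n (\val x) (fun b => ~ (val @` A) b).
Proof.
split=> [dA [O [cO Oa OU]]|npn U /theta_nbhs_fin[s [ss sx sU]]].
  (* Points above [x] are cut off by an open set, either [{0}] or the interval from 0 to [osucc x],
     so a limit point is approached from below. *)
  have Un : nbhs (x : theta n Omega) [set y : theta n Omega | O (\val y) /\ \val y <= \val x].
    apply: filterI; first exact: cyl_nbhs.
    have [x0|x0] := eqVneq (\val x) ozero.
      apply: filterS (_ : nbhs (x : theta n Omega) [set y | \val y = ozero]).
        by move=> y /= ->; exact: ozero_le.
      by apply: theta_subbase_nbhs => //; left; left.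
    apply: filterS (_ : nbhs (x : theta n Omega)
        ([set y | ozero < \val y < osucc (\val x)])).
      by move=> y /= /andP[_]; rewrite lt_osucc.
    apply: theta_subbase_nbhs; last by rewrite /= lt0_neq x0 ltSo.
    left; right; exists ozero, (osucc (\val x)); split=> //.
      by rewrite lt0_neq osucc_neq0.
    by rewrite osucc_le; exact: (valP x).
  have [y [yx Ay [Oy ylex]]] := dA _ Un.
  apply: (OU (\val y)) => //; last by exists y.
  by rewrite lt_neqAle ylex andbT; apply: contra yx => /eqP/val_inj ->.
apply: contrapT => nE; apply: npn.
(* Induction on the finite set of subbasic sets, splitting off one member at a time, makes their
   intersection a single punctured neighbourhood. *)
have : pn n (\val x) (fun b => forall h : b < Omega, forall S, S \in s -> S (exist _ b h)).
  move: ss sx; elim/finSet_rect: s {sU} => s IH ss sx.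
  have [->|[S Ss]] := fset_0Vmem s.
    by apply: pnT => b _ h S; rewrite in_fset0.
  have /pnW : pn n (\val x) ((fun b => forall h : b < Omega, S (exist _ b h)) `&`
     (fun b => forall h : b < Omega, forall T, T \in (s `\ S)%fset -> T (exist _ b h))).
    apply: pnI; first by apply: pn_subbase; [move/ss: Ss; rewrite inE|exact: sx].
    apply: IH; first exact: fproperD1.
      by move=> T; rewrite in_fsetD1 => /andP[_ /ss].
    by move=> T; rewrite in_fsetD1 => /andP[_ /sx].
  apply=> b _ [H1 H2] h T Ts; have [->//|TS] := eqVneq T S.
  by apply: H2; rewrite in_fsetD1 TS.
apply: pnW => b bx H [y Ay yb]; apply: nE; exists y; split=> //.
  by apply/eqP => yx; move: bx; rewrite -yb yx ltxx.
apply: sU => S Ss; have h : b < Omega by rewrite (lt_trans bx)//; exact: (valP x).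
by have := H h S Ss; congr S; apply: val_inj.
Qed.

End theta.

(** * Soundness *)

Lemma pn_nlimit n a U : ~ is_limit a -> pn n a U.
Proof.
move=> aL; apply: (@pn_mono 0) => //; apply/pn0P.
case: (ord_case a) => [->|[y ->] _|//]; first by rewrite eqxx.
exists y; first exact: ltSo.
by move=> b /andP[yb]; rewrite lt_osucc leNgt yb.
Qed.

Lemma pnS_ell n a V : pn n (ell a) V -> pn n.+1 a [set b | V (ell b)].
Proof.
move=> pV; apply/pnSP; exists V; split=> //.
by rewrite -lt0_neq => a0; exists ozero.
Qed.

(** The points of rank above [s] form an open set from the topology of index 1 on. *)
Lemma pnS_high n a g s (U : set Ord) : g < a -> s < ell a ->
  (forall b, g < b < a -> s <= ell b -> U b) -> pn n.+1 a U.
Proof.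
move=> ga sa H; apply/pnSP; exists [set x | s <= x]; split.
  by exists [set x | s < iter 0 ell x]; split=> //; [exact: cyl_gt|move=> b _ /ltW].
by move=> _; exists g.
Qed.

Arguments pnS_high {n a g s U} _ _ _.

Lemma pn_eq_pos n a (U V : set Ord) : ozero < a ->
  (forall b, ozero < b -> b < a -> U b <-> V b) -> pn n a U <-> pn n a V.
Proof.
move=> a0 UV; have p0 : pn n a [set x | ozero < iter 0 ell x].
  by apply: pn_cyl => //; exact: cyl_gt.
by split=> /(pnI p0); apply: pnW => b ba [b0] /(UV _ b0 ba).
Qed.

(** ** Homogeneous sets *)

(* Near [a], the set [B] looks the same in all blocks of length [omega_pow s]
   starting at points of rank at least [s]. *)
Definition hom (B : set Ord) (a g s : Ord) : Prop :=
  [/\ g < a, s < ell a & forall b c r, g < b < a -> g < c < a ->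
    s <= ell b -> s <= ell c -> r < omega_pow s -> (B (b +o r) <-> B (c +o r))].

(** Only points of limit rank are constrained: at any other point the rank is isolated, and so the
    point is isolated from the topology of index 1 on. *)
Definition tame (B : set Ord) : Prop :=
  forall a, is_limit (ell a) -> exists g s, hom B a g s.

Lemma lt_add_near a b r : b < a -> r < omega_pow (ell a) -> b +o r < a.
Proof.
move=> ba ra; have [c aE] := ell_cnf (le_lt_trans (ozero_le _) ba).
have [bc|/ltW/osub_ex[d bE]] := leP b c.
  apply: le_lt_trans (oadd_leL _ bc) _; by rewrite [X in _ < X]aE oadd_lt.
rewrite bE -oaddA [X in _ < X]aE oadd_lt omega_pow_add_lt//.
by rewrite -(oadd_lt c) -bE -aE.
Qed.

Lemma ell_ge_add b s q : s <= ell b -> s <= ell (b +o omega_pow s *o q).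
Proof.
move=> sb; have [->|] := eqVneq q ozero; first by rewrite omul0 oadd0.
rewrite -lt0_neq => q0; rewrite ellD ?omul_gt0 ?omega_pow_gt0//.
by rewrite ell_omega_powM// le_oaddr.
Qed.

Lemma block_decomp h y s : h <= y -> s <= ell h ->
  exists b r, [/\ y = b +o r, h <= b, s <= ell b & r < omega_pow s].
Proof.
move=> /osub_ex[d ->] sh; have [q [r [-> rs]]] := odiv_ex d (omega_pow_gt0 s).
exists (h +o omega_pow s *o q), r; split; rewrite ?oaddA ?le_oaddr//.
exact: ell_ge_add.
Qed.

(** A block of length [omega_pow s'] is made of blocks of length [omega_pow s] whose starting points
    have rank at least [s]; the offset [r] is divided accordingly. *)
Lemma hom_mono B a g s g' s' : hom B a g s -> g <= g' -> g' < a ->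
  s <= s' -> s' < ell a -> hom B a g' s'.
Proof.
move=> [ga sa H] gg ga' ss sa'; split=> // b c r /andP[gb ba] /andP[gc ca] sb sc rs.
have [q [t [rE ts]]] := odiv_ex r (omega_pow_gt0 s).
have ra : r < omega_pow (ell a) by rewrite (lt_trans rs)// omega_pow_lt.
have qr : omega_pow s *o q <= r by rewrite rE le_oaddr.
rewrite rE !oaddA; apply: H => //.
- by rewrite lt_add_near ?(le_lt_trans qr)// (lt_le_trans _ (le_oaddr _ _))// (le_lt_trans gg).
- by rewrite lt_add_near ?(le_lt_trans qr)// (lt_le_trans _ (le_oaddr _ _))// (le_lt_trans gg).
- exact/ell_ge_add/(le_trans ss).
- exact/ell_ge_add/(le_trans ss).
Qed.

Lemma hom_const B a g s b c : hom B a g s -> g < b < a -> g < c < a ->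
  s <= ell b -> s <= ell c -> B b <-> B c.
Proof.
move=> [_ _ H] gb gc sb sc; have := H b c ozero gb gc sb sc (omega_pow_gt0 s).
by rewrite !oadd0.
Qed.

Lemma tame_not B : tame B -> tame (~` B).
Proof.
move=> tB a /tB[g [s [ga sa H]]]; exists g, s; split=> // b c r gb gc sb sc rs.
by have [BC CB] := H b c r gb gc sb sc rs; split=> n m; apply: n; auto.
Qed.

Lemma tame_or B C : tame B -> tame C -> tame (B `|` C).
Proof.
move=> tB tC a aL; have [g [s hB]] := tB a aL; have [h [t hC]] := tC a aL.
exists (Order.max g h), (Order.max s t).
have [ga sa _] := hB; have [ha ta _] := hC.
have gha : Order.max g h < a by rewrite gt_max ga.
have sta : Order.max s t < ell a by rewrite gt_max sa.
have [_ _ HB] : hom B a (Order.max g h) (Order.max s t).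
  by apply: (hom_mono hB) => //; rewrite le_max lexx.
have [_ _ HC] : hom C a (Order.max g h) (Order.max s t).
  by apply: (hom_mono hC) => //; rewrite le_max lexx orbT.
split=> // b c r gb gc sb sc rs.
by have := HB b c r gb gc sb sc rs; have := HC b c r gb gc sb sc rs; rewrite /setU /=; tauto.
Qed.

Lemma tame0 : tame set0.
Proof.
move=> a aL; exists ozero, ozero; split=> //; last exact: limit_gt0.
exact/(lt_le_trans (limit_gt0 aL))/ell_le.
Qed.

(** For boxes, the two kinds of positions call for different arguments: at a positive offset only
    the inside of the block matters, by translation, whereas a starting point sees what precedes it.
    For the latter one implication is enough, by symmetry in [b] and [c]. *)
Lemma tame_local (F : set Ord) :
  (forall a, is_limit (ell a) -> exists g s, [/\ g < a, s < ell a,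
     forall b c r, g < b < a -> g < c < a -> s <= ell b -> s <= ell c ->
       ozero < r -> r < omega_pow s -> F (b +o r) <-> F (c +o r) &
     forall b c, g < b < a -> g < c < a -> s <= ell b -> s <= ell c -> F b -> F c]) ->
  tame F.
Proof.
move=> H a /H[g [s [ga sa Ht Hc]]]; exists g, s; split=> // b c r gb gc sb sc rs.
have [->|] := eqVneq r ozero; last by rewrite -lt0_neq => r0; exact: Ht.
by rewrite !oadd0; split; exact: Hc.
Qed.

(** * Boxes of a clause: the union of a tame set and an [ell]-preimage *)

Section clause.
Variables (B A : set Ord).
Hypothesis tB : tame B.

Let C : set Ord := [set a | B a \/ A (ell a)].

(** Either [C] fails at a positive offset [r] inside a block; the failure then recurs at this offset
    in every block, because [B] is homogeneous and [b +o r] has the rank of [r]. Or failures past a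
    point of rank [s] occur only at block starts; one of them then recurs at all points of its rank.
    In both cases failures accumulate at every point near [a] of larger rank. *)
Lemma clause_diamond0 a : is_limit (ell a) -> ~ pn 0 a C ->
  exists g s, [/\ g < a, s < ell a &
    forall b, g < b < a -> s <= ell b -> ~ pn 0 b C].
Proof.
move=> aL npn; have [g [s hB]] := tB aL; have [ga sa HB] := hB.
have cof h : h < a -> exists2 y, h < y < a & ~ C y.
  move=> ha; apply: contrapT => nE; apply: npn; apply/pn0P => _; exists h => // b hb.
  by apply: contrapT => nC; apply: nE; exists b.
have [[b [gb sb [r [r0 rs nC]]]]|none] := pselect (exists b, [/\ g < b < a, s <= ell b &
    exists r, [/\ ozero < r, r < omega_pow s & ~ C (b +o r)]]).
  exists g, (osucc s); split=> //; first exact: limit_succ.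
  move=> c /andP[gc ca]; rewrite osucc_le => sc /pn0P.
  rewrite -lt0_neq (le_lt_trans (ozero_le _) gc) => /(_ isT)[h hc hC].
  have [y /andP[hy yc] ys] : exists2 y, Order.max h g < y < c & ell y = s.
    by apply: ell_cofinal => //; rewrite gt_max hc.
  move: hy; rewrite gt_max => /andP[hy gy]; apply: nC.
  have := hC (y +o r); rewrite (lt_le_trans hy (le_oaddr _ _)) /=.
  rewrite lt_add_near ?(lt_trans rs) ?omega_pow_lt// => /(_ isT).
  rewrite /C /= !ellD// => -[By|]; [left|by right].
  by apply/(HB b y r); rewrite ?gb ?gy ?ys ?(lt_trans yc).
have [n na near] := ell_near (le_lt_trans (ozero_le _) ga).
have [h /andP[gnh ha] hs] : exists2 y, Order.max g n < y < a & ell y = s.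
  by apply: ell_cofinal => //; rewrite gt_max ga.
move: gnh; rewrite gt_max => /andP[gh nh].
have [y /andP[hy ya] nC] := cof h ha.
(* A failure past the block start [h] is itself a block start, as [none] excludes positive
   offsets. *)
have sy : s <= ell y.
  have sh : s <= ell h by rewrite hs.
  have [b [r [yE hb sb rs]]] := block_decomp (ltW hy) sh.
  have [r0|] := eqVneq r ozero; first by rewrite yE r0 oadd0.
  rewrite -lt0_neq => r0; exfalso; apply: none; exists b; split=> //.
    by rewrite (lt_le_trans gh)//= (le_lt_trans _ ya)// yE le_oaddr.
  by exists r; rewrite -yE.
have ey : ell y < ell a by apply: near; rewrite ya (lt_trans nh).
exists g, (osucc (ell y)); split=> //; first exact: limit_succ.
move=> c /andP[gc ca]; rewrite osucc_le => yc /pn0P.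
rewrite -lt0_neq (le_lt_trans (ozero_le _) gc) => /(_ isT)[k kc kC].
have [z /andP[kz zc] zs] : exists2 z, Order.max k g < z < c & ell z = ell y.
  by apply: ell_cofinal => //; rewrite gt_max kc.
move: kz; rewrite gt_max => /andP[kz gz]; apply: nC.
have := kC z; rewrite kz zc => /(_ isT); rewrite /C /= zs => -[Bz|]; [left|by right].
suff [+ _] : B z <-> B y by exact.
by apply: (hom_const hB); rewrite ?zs ?ya ?gz ?(lt_trans zc) ?(lt_trans gh).
Qed.

Lemma tame_pn0_clause : tame (fun a => pn 0 a C).
Proof.
apply: tame_local => a aL; have [g [s hB]] := tB aL; have [ga sa HB] := hB.
have trans b c r g' s' : hom B a g' s' -> g' < b < a -> g' < c < a -> s' <= ell b ->
    s' <= ell c -> ozero < r -> r < omega_pow s' -> pn 0 (b +o r) C <-> pn 0 (c +o r) C.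
  move=> [_ _ H] gb gc sb sc r0 rs; rewrite !pnD//; apply: pn_eq_pos => // x x0 xr.
  rewrite /C /= !ellD//; have := H b c x gb gc sb sc (lt_trans xr rs); tauto.
(* At block starts: an interval inside [C] ending at [a] serves all points in it; if there is none,
   the box fails at all block starts of large rank by [clause_diamond0]. *)
have [/pn0P|npn] := pselect (pn 0 a C).
  rewrite -lt0_neq (le_lt_trans (ozero_le _) ga) => /(_ isT)[h ha hC].
  have gha : Order.max g h < a by rewrite gt_max ga.
  have hB' : hom B a (Order.max g h) s by apply: (hom_mono hB); rewrite // le_max lexx.
  exists (Order.max g h), s; split=> //; first by move=> b c r; exact: trans.
  move=> b c _; rewrite gt_max -andbA => /and3P[gc hc ca] _ _ _.
  apply/pn0P => _; exists h => // x /andP[hx xc]; apply: hC.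
  by rewrite hx (lt_trans xc).
have [h [t [ha ta H]]] := clause_diamond0 aL npn.
have gha : Order.max g h < a by rewrite gt_max ga.
have sta : Order.max s t < ell a by rewrite gt_max sa.
have hB' : hom B a (Order.max g h) (Order.max s t).
  by apply: (hom_mono hB); rewrite // le_max lexx.
exists (Order.max g h), (Order.max s t); split=> //; first by move=> b c r; exact: trans.
move=> b c; rewrite gt_max -andbA => /and3P[_ hb ba] _; rewrite ge_max => /andP[_ tb] _ /H.
by case=> //; rewrite hb.
Qed.

(** The contribution of [B] to a box over the clause, the same for every index from 1 on; see
    [pnS_clause]. *)
Definition rank_lim a : Prop :=
  exists g s, [/\ g < a, s < ell a & forall b, g < b < a -> s <= ell b -> B b].

(** Near [a], membership in [B] is constant on the points of rank at least [s], and [rank_lim b]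
    supplies one such point in [B]. *)
Lemma rank_lim_hom a g s b : hom B a g s -> g < b < a -> s < ell b -> rank_lim b ->
  forall y, g < y < a -> s <= ell y -> B y.
Proof.
move=> hB /andP[gb ba] sb [h [t [hb tb H]]] y gy sy.
have [z /andP[hz zb] zs] : exists2 z, Order.max g h < z < b & ell z = Order.max s t.
  by apply: ell_cofinal => //; rewrite gt_max ?sb ?tb ?hb ?gb.
move: hz; rewrite gt_max => /andP[gz hz].
apply/(@hom_const _ _ _ _ y z hB) => //; rewrite ?gz ?zs ?le_max ?lexx ?(lt_trans zb)//.
by apply: H; rewrite ?hz// zs le_max lexx orbT.
Qed.

Lemma rank_limD b r : ozero < r -> rank_lim (b +o r) <->
  exists h s, [/\ h < r, s < ell r &
    forall x, ozero < x -> h < x < r -> s <= ell x -> B (b +o x)].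
Proof.
move=> r0; rewrite /rank_lim ellD//; split=> [[g [s [gr sr H]]]|[h [s [hr sr H]]]].
  have [gb|bg] := leP g b.
    exists ozero, s; split=> // x x0 /andP[_ xr] sx.
    by apply: H; rewrite ?ellD// oadd_lt xr andbT (le_lt_trans gb)// lt_oaddr.
  have [h gE] := osub_ex (ltW bg); rewrite gE oadd_lt in gr.
  exists h, s; split=> // x x0 hx sx; apply: H; rewrite ?ellD//.
  by rewrite gE !oadd_lt.
exists (b +o h), s; split; rewrite ?oadd_lt// => y /andP[hy].
have [x yE] := osub_ex (le_trans (le_oaddr b h) (ltW hy)).
rewrite yE !oadd_lt in hy * => xr; have x0 := le_lt_trans (ozero_le _) hy.
by rewrite ellD// => sx; apply: H; rewrite ?hy.
Qed.

Lemma tame_rank_lim : tame rank_lim.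
Proof.
apply: tame_local => a aL; have [g [s hB]] := tB aL; have [ga sa HB] := hB.
(* [rank_lim_hom] asks for block starts of rank strictly above [s], hence the next size of
   blocks. *)
have sa' : osucc s < ell a by exact: limit_succ.
have [_ _ H] : hom B a g (osucc s) by apply: (hom_mono hB); rewrite // ltW ?ltSo.
exists g, (osucc s); split=> //.
  move=> b c r gb gc sb sc r0 rs; rewrite !rank_limD//.
  split=> -[h [t [hr tr K]]]; exists h, t; split=> // x x0 /[dup] hx /andP[_ xr] tx.
    by apply/(H b c x gb gc sb sc (lt_trans xr rs)); exact: K.
  by apply/(H b c x gb gc sb sc (lt_trans xr rs)); exact: K.
move=> b c gb /andP[gc ca] ; rewrite !osucc_le => sb sc Lb.
exists g, s; split=> // y /andP[gy yc]; apply: (rank_lim_hom hB gb sb Lb).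
by rewrite gy (lt_trans yc).
Qed.

(** Near a point of limit rank, the points of rank at least [s] are all in [B] or all outside. In
    the first case [rank_lim] holds. In the second, [A] must hold at the large ranks in the
    neighbourhood, and every rank below [ell a] is taken by points arbitrarily close to [a]. *)
Lemma pnS_clause n a : pn n.+1 a C <-> rank_lim a \/ pn n (ell a) A.
Proof.
split=> [/pnSP[V [pV H]]|[[g [s [ga sa H]]]|]]; last 2 first.
- by apply: (pnS_high ga sa) => b gb sb; left; exact: H.
- by move=> /pnS_ell; apply: pnW => b _; right.
have [aL|aL] := pselect (is_limit (ell a)); last by right; exact: pn_nlimit.
have [g [s hB]] := tB aL; have [ga sa HB] := hB.
have [[b [gb sb Bb]]|none] := pselect (exists b, [/\ g < b < a, s <= ell b & B b]).
  left; exists g, s; split=> // c gc sc; exact/(hom_const hB gb gc sb sc).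
right; have := H; rewrite -lt0_neq (le_lt_trans (ozero_le _) ga) => /(_ isT)[h ha hC].
have ps : pn n (ell a) [set x | s < iter 0 ell x] by apply: pn_cyl => //; exact: cyl_gt.
apply: pnW (pnI pV ps) => e ea [Ve /= se].
have [y /andP[hy ya] ye] : exists2 y, Order.max g h < y < a & ell y = e.
  by apply: ell_cofinal => //; rewrite gt_max ga.
move: hy; rewrite gt_max => /andP[gy hy].
have := hC y; rewrite ye hy ya => /(_ isT Ve); rewrite /C /= ye => -[By|//].
by exfalso; apply: none; exists y; rewrite gy ye ltW.
Qed.

End clause.

(** An algebra containing the sets that come from all [Hfam n]. As the empty set is tame,
    implication yields the other boolean operations; closure under boxes is [good_pn]. *)
Inductive good : set Ord -> Prop :=
| good_base B of tame B : good B
| good_ell A of good A : good [set a | A (ell a)]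
| good_imp A B of good A & good B : good [set a | A a -> B a].

Lemma good0 : good set0. Proof. exact/good_base/tame0. Qed.

Lemma good_not A : good A -> good (~` A).
Proof. by move=> gA; exact: good_imp gA good0. Qed.

Lemma good_or A B : good A -> good B -> good (A `|` B).
Proof.
move=> gA gB; suff -> : A `|` B = [set a | (~` A) a -> B a].
  exact/good_imp/gB/good_not.
apply/seteqP; split=> a /=; first by case.
by move=> H; have [|/H] := pselect (A a); [left|right].
Qed.

Lemma good_and A B : good A -> good B -> good (A `&` B).
Proof.
move=> gA gB; rewrite -(setCK (A `&` B)) setCI.
exact/good_not/good_or/good_not/gB/good_not.
Qed.

(** Boxes commute with finite intersections, so only clauses have to be treated. One tame disjunct
    and one [ell]-preimage are enough in a clause, both kinds being closed under union. *)
Inductive cnf : set Ord -> Prop :=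
| cnfT : cnf setT
| cnf_clause B A X of tame B & good A & cnf X :
    cnf ([set a | B a \/ A (ell a)] `&` X).

Lemma cnf1 B A : tame B -> good A -> cnf [set a | B a \/ A (ell a)].
Proof. by move=> tB gA; rewrite -[X in cnf X]setIT; apply: cnf_clause => //; exact: cnfT. Qed.

Lemma cnf_and X Y : cnf X -> cnf Y -> cnf (X `&` Y).
Proof.
elim=> [|B A X' tB gA _ IH] cY; first by rewrite setTI.
by rewrite -setIA; apply: cnf_clause => //; exact: IH.
Qed.

Lemma cnf_or X Y : cnf X -> cnf Y -> cnf (X `|` Y).
Proof.
elim=> [|B A X' tB gA _ IH] cY; first by rewrite setTU; exact: cnfT.
rewrite setUIl; apply: cnf_and; last exact: IH.
elim: cY {IH} => [|B' A' Y' tB' gA' _ IH]; first by rewrite setUT; exact: cnfT.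
rewrite setUIr; apply: cnf_and => //.
have := cnf1 (tame_or tB tB') (good_or gA gA'); congr cnf.
by apply/seteqP; split=> a /=; rewrite /setU /=; tauto.
Qed.

Lemma cnf_not X : cnf X -> cnf (~` X).
Proof.
have c0 : cnf set0.
  have := cnf1 tame0 good0; congr cnf.
  by apply/seteqP; split=> a /=; tauto.
elim=> [|B A X' tB gA _ IH]; first by rewrite setCT.
rewrite setCI; apply: cnf_or => //.
have := cnf_and (cnf1 (tame_not tB) good0) (cnf1 tame0 (good_not gA)); congr cnf.
by apply/seteqP; split=> a /=; rewrite /setC /setI /set0 /mkset; tauto.
Qed.

Lemma good_cnf X : good X -> cnf X.
Proof.
elim=> [B tB|A gA _|A B _ cA _ cB].
- have := cnf1 tB good0; congr cnf.
  by apply/seteqP; split=> a /=; tauto.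
- have := cnf1 tame0 gA; congr cnf.
  by apply/seteqP; split=> a /=; tauto.
- have := cnf_or (cnf_not cA) cB; congr cnf.
  apply/seteqP; split=> a /=; rewrite /setU /setC /=; first tauto.
  by move=> H; have [/H|] := pselect (A a); tauto.
Qed.

Lemma pnIP n a U V : pn n a (U `&` V) <-> pn n a U /\ pn n a V.
Proof.
split=> [H|[]]; last exact: pnI.
by split; apply: pnW H => b _ [].
Qed.

Lemma good_pn n X : good X -> good (fun a => pn n a X).
Proof.
elim: n X => [|n IHn] X /good_cnf; elim=> [|B A {}X tB gA _ gX].
- suff -> : (fun a => pn 0 a setT) = setT :> set Ord by rewrite -setC0; exact/good_not/good0.
  by apply/seteqP; split=> // a _; exact: pnT.
- rewrite (_ : (fun a => _) = (fun a => pn 0 a [set a | B a \/ A (ell a)]) `&` (fun a => pn 0 a X)).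
    apply: good_and => //; exact/good_base/tame_pn0_clause.
  by apply/seteqP; split=> a /pnIP.
- suff -> : (fun a => pn n.+1 a setT) = setT :> set Ord by rewrite -setC0; exact/good_not/good0.
  by apply/seteqP; split=> // a _; exact: pnT.
- rewrite (_ : (fun a => _) = (rank_lim B `|` [set a | pn n (ell a) A]) `&` (fun a => pn n.+1 a X)).
    apply: good_and => //; apply: good_or; first exact/good_base/tame_rank_lim.
    exact/(@good_ell (fun a => pn n a A))/IHn.
  apply/seteqP; split=> a.
    by move=> /pnIP[/(pnS_clause _ tB) ? ?].
  by move=> [/(pnS_clause _ tB) ? ?]; apply/pnIP.
Qed.

(** The axiom [<m>f -> [n]<m>f] for [n = m + 1]. On a clause, index 0 is [clause_diamond0]. At a
    positive index, the failure of the box on [A] is pulled back along [ell] from the induction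
    hypothesis, and the failure of [rank_lim] spreads to points of large rank by [rank_lim_hom]. *)
Lemma good_diamond_open m X a : good X -> ~ pn m a X ->
  pn m.+1 a (fun b => ~ pn m b X).
Proof.
elim: m X a => [|m IHm] X a /good_cnf; elim=> [|B A {}X tB gA _ IH].
- by case; exact: pnT.
- rewrite pnIP => /not_andP[npn|/IH]; last by apply: pnW => b _ nX /pnIP[].
  have [aL|aL] := pselect (is_limit (ell a)); last first.
    (* The rank of [a] is isolated, so even the empty set contains a punctured neighbourhood of
       it. *)
    by apply: pnW (pnS_ell (@pn_nlimit 0 (ell a) set0 aL)).
  have [g [s [ga sa H]]] := clause_diamond0 tB aL npn.
  by apply: (pnS_high ga sa) => b gb sb /pnIP[/(H _ gb sb)].
- by case; exact: pnT.
- rewrite pnIP => /not_andP[npn|/IH]; last by apply: pnW => b _ nX /pnIP[].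
  have [nR nA] : ~ rank_lim B a /\ ~ pn m (ell a) A.
    by split=> H; apply: npn; apply/pnS_clause => //; [left|right].
  have pA := pnS_ell (IHm _ _ gA nA).
  have pR : pn m.+2 a (fun b => ~ rank_lim B b).
    have [aL|aL] := pselect (is_limit (ell a)); last first.
      by apply: pnW (pnS_ell (@pn_nlimit m.+1 (ell a) set0 aL)).
    have [g [s hB]] := tB _ aL; have [ga sa _] := hB.
    apply: (pnS_high ga (limit_succ aL sa)) => b gb; rewrite osucc_le => sb Lb.
    by apply: nR; exists g, s; split=> //; exact: rank_lim_hom hB gb sb Lb.
  apply: pnW (pnI pA pR) => b _ [/= nAb nRb] /pnIP[/(pnS_clause _ tB)[]//].
Qed.

(** ** Validity of the axioms *)

(** Formulas are evaluated at all ordinals: [pn n a] looks only below [a], so truncation at [Omega]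
    changes no truth value below [Omega]; see [interp_sat]. *)
Fixpoint sat (v : nat -> set Ord) (f : form) : set Ord :=
  match f with
  | Var p => v p
  | Bot => set0
  | Imp g k => [set a | sat v g a -> sat v k a]
  | Box n g => [set a | pn n a (sat v g)]
  end.

Lemma good_sat v f : (forall p, good (v p)) -> good (sat v f).
Proof.
move=> gv; elim: f => [p||g IHg k IHk|n g IH] //=; first exact: good0.
  exact: good_imp.
exact: good_pn.
Qed.

(** The same [O] witnesses the inner boxes at all of its points, and well-founded induction runs
    along [O]. *)
Lemma pn_Lob n a U : pn n a [set b | pn n b U -> U b] -> pn n a U.
Proof.
move=> [O [cO Oa OU]]; exists O; split=> //; apply: lt_ind => b IH ba Ob.
apply: OU => //; exists O; split=> // c cb Oc; apply: IH => //; exact: lt_trans ba.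
Qed.

Lemma GLP_sat v f : (forall p, good (v p)) -> GLP f -> forall a, sat v f a.
Proof.
move=> gv; elim=> {f}.
- move=> f tf a; have := tf (fun g => `[< sat v g a >]).
  suff -> : bool_eval (fun g => `[< sat v g a >]) f = `[< sat v f a >] by move/asboolP.
  elim: f {tf} => //= [|g -> k ->]; first by apply/esym/asboolPn.
  by apply/idP/asboolP => [/implyP H /asboolP/H/asboolP//|H]; apply/implyP => /asboolP/H/asboolP.
- move=> n f g a /= pfg pf; apply: pnW (pnI pfg pf) => b _ [/= H]; exact: H.
- by move=> n f a /=; exact: pn_Lob.
- move=> m n f mn a /= D.
  apply: (pn_mono mn); apply: pnW (good_diamond_open (good_sat (Neg f) gv) D).
  by [].
- by move=> m n f mn a /=; exact: pn_mono.
- by move=> f g _ Hfg _ Hf a; exact: Hfg (Hf a).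
- by move=> n f _ Hf a; apply: pnT => b _; exact: Hf.
Qed.

Lemma interp_sat Omega (v : nat -> set (Below Omega)) f (x : Below Omega) :
  interp (derivative Omega) v f x <-> sat (fun p => \val @` v p) f (\val x).
Proof.
elim: f x => [p||g IHg k IHk|n g IH] x //=.
- by split=> [vx|[y vy /val_inj <-]//]; exists x.
- rewrite -IHg -IHk; split=> [[]//|H].
  by have [/H|] := pselect (interp (derivative Omega) v g x); [right|left].
- split=> [/derivativeP|pn] /=.
    move=> /contrapT; apply: pnW => b bx H.
    have h : b < Omega by rewrite (lt_trans bx)//; exact: (valP x).
    apply/(IH (exist _ b h)); apply: contrapT => nI; apply: H.
    by exists (exist _ b h).
  move=> /derivativeP; apply; apply: pnW pn => b bx sb [y ny yb].
  by apply: ny; apply/IH; rewrite yb.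
Qed.

(** * Periodic words *)

Lemma wat_mkword x f y : wat (mkword x f) y = (y < x) && f y.
Proof.
rewrite /wat /mkword /=; case: insubP => [z zx /= ->|/negbTE -> //].
by rewrite zx.
Qed.

Lemma wat_ge A y : wlen A <= y -> wat A y = false.
Proof. by move=> Ay; rewrite /wat insubF// ltNge Ay. Qed.

Lemma word_ext A B : wlen A = wlen B -> (forall y, y < wlen A -> wat A y = wat B y) -> A = B.
Proof.
case: A B => [x f] [x' g] /= xx; move: f g; rewrite {}xx => f g H; congr Word.
apply/funext => y; have := H _ (valP y).
by rewrite /wat !valK.
Qed.

Lemma wat_wcat A B y : y < wlen B -> wat (wcat A B) (wlen A +o y) = wat B y.
Proof.
by move=> yB; rewrite wat_mkword oadd_lt yB/= ltNge le_oaddr /= osubK.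
Qed.

Lemma wat_wcatl A B y : y < wlen A -> wat (wcat A B) y = wat A y.
Proof. by move=> yA; rewrite wat_mkword yA (lt_le_trans yA)// le_oaddr. Qed.

Lemma wpow_spec A l : wlen (wpow A l) = wlen A *o l /\
  forall q r, q < l -> r < wlen A -> wat (wpow A l) (wlen A *o q +o r) = wat A r.
Proof.
elim/ord_ind3: l => [|l [IHl IH]|l lL IH].
- by rewrite /wpow orec0 omul0; split=> // q r; rewrite ltNge0.
- rewrite (_ : wpow A _ = wcat (wpow A l) A); last exact: orecS.
  rewrite /= IHl omulS; split=> // q r.
  rewrite lt_osucc le_eqVlt => /predU1P[->|ql] rA; first by rewrite -IHl wat_wcat.
  rewrite wat_wcatl; first exact: IH.
  rewrite IHl; apply: lt_le_trans (_ : wlen A *o osucc q <= _).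
    by rewrite omulS oadd_lt.
  by rewrite omul_leW// osucc_le.
- rewrite (_ : wpow A l = wunion (wpow A @` [set y | y < l])); last exact: orecL.
  split.
    rewrite /= image_comp [RHS]/omul orecL//; congr osup.
    by apply: eq_imagel => y yl /=; have [] := IH _ yl.
  move=> q r ql rA; have qSl := limit_succ lL ql.
  rewrite wat_mkword; apply/andP/idP => [[_ /asboolP[_ [y yl <-]]]|Ar].
    have [yE IHy] := IH _ yl; have [qy|yq] := ltP q y; first by rewrite IHy.
    rewrite wat_ge// yE; apply: le_trans (le_oaddr _ _).
    exact: omul_leW.
  split; last first.
    apply/asboolP; exists (wpow A (osucc q)); first by exists (osucc q).
    by rewrite (IH _ qSl).2// ltSo.
  rewrite image_comp; apply/(lt_supL (fun y => wlen (wpow A y))).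
  exists (osucc q) => //; rewrite (IH _ qSl).1 omulS oadd_lt//.
Qed.

(** The alphabet is arbitrary so that both sets, with letters in [Prop], and colourings can be read
    as ultimately periodic words. *)
Definition repeats (T : Type) (c : Ord -> T) (x g p l : Ord) : Prop :=
  [/\ ozero < p, is_limit l, x = g +o p *o l &
    forall q r, q < l -> r < p -> c (g +o (p *o q +o r)) = c (g +o r)].

Lemma up_inP (X : set Ord) x : up_in X x <-> exists g p l, repeats X x g p l.
Proof.
split=> [[B [_ [[A [l [A0 lL ->]]] E]]]|[g [p [l [p0 lL xE H]]]]].
  have [lenE watE] := wpow_spec A l.
  exists (wlen B), (wlen A), l.
  have xE : x = wlen B +o wlen A *o l by rewrite -lenE; exact: (congr1 wlen E).
  have XE q r : q < l -> r < wlen A -> X (wlen B +o (wlen A *o q +o r)) = wat A r.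
    move=> ql rA; have lt : wlen A *o q +o r < wlen A *o l.
      rewrite -(oadd0 (wlen A *o l)); exact: odiv_lt.
    have := congr1 (fun W => wat W (wlen B +o (wlen A *o q +o r))) E.
    rewrite wat_mkword wat_wcat ?lenE// watE// xE oadd_lt lt /= => <-.
    by apply/propext; split=> /asboolP.
  split=> //; first by rewrite lt0_neq.
  move=> q r ql rA; rewrite XE// -[r in RHS](add0o r) -(omul0 (wlen A)) XE//.
  exact: limit_gt0.
set A := mkword p (fun r => `[< X (g +o r) >]); set B := mkword g (fun y => `[< X y >]).
exists B, (wpow A l); have [lenE watE] := wpow_spec A l.
split; first by exists A, l; split=> //=; rewrite -lt0_neq.
apply: word_ext; first by rewrite /= lenE.
move=> y /= yx; rewrite wat_mkword yx /=.
have [yg|gy] := ltP y g; first by rewrite wat_wcatl// wat_mkword yg.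
have [d yE] := osub_ex gy; have [q [r [dE rp]]] := odiv_ex d p0.
have ql : q < l.
  rewrite ltNge; apply/negP => lq; move: yx; rewrite xE yE oadd_lt dE ltNge.
  by rewrite (le_trans (omul_leW _ lq))// le_oaddr.
rewrite yE dE wat_wcat; last by rewrite lenE /= -(oadd0 (p *o l)); exact: odiv_lt.
by rewrite watE// wat_mkword rp /= H.
Qed.

(** If [b] is the leading exponent of the period, then [p *o omega] equals [omega_pow (osucc b)].
    Hence points near [a] of rank at least [osucc b] lie a whole number of periods after [g], and
    blocks starting there are in phase. *)
Lemma repeats_tame (X : set Ord) a g p l : is_limit (ell a) -> repeats X a g p l ->
  exists h s, hom X a h s.
Proof.
move=> aL [p0 lL aE H]; have [b [bp pb]] := omega_log p0.
have e0 := (limit_ell l).1 lL.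
have [l' [e lE]] := cnf_last (limit_gt0 lL).
have ellE : ell a = b +o ell l.
  by rewrite aE ellD ?(ell_mul_limit bp pb)// limit_gt0//; exact: omul_limit.
have sa : osucc b < ell a by apply: limit_succ => //; rewrite ellE lt_oaddr.
have pw := omulo_omega bp pb.
(* [l'] is [l] without its last Cantor term, so this point lies below [a] and a whole number of
   periods after [g]. *)
exists (g +o p *o l'), (osucc b); split=> //.
  by rewrite [X in _ < X]aE lE omulDr oaddA lt_oaddr// omul_gt0 ?omega_pow_gt0.
have block y i r : g +o p *o l' < y < a -> osucc b <= ell y -> r < p ->
    p *o i +o r < omega_pow (osucc b) -> X (y +o (p *o i +o r)) = X (g +o r).
  move=> /andP[gy ya] by_ rp ib; have := lt_add_near ya (lt_trans ib (omega_pow_ltr sa)).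
  have [x yE] := osub_ex (ltW gy); have x0 : ozero < x.
    by move: gy; rewrite yE -{1}(oadd0 (g +o p *o l')) oadd_lt.
  have [k k0 xE] : exists2 k, ozero < k & x = omega_pow (osucc b) *o k.
    by apply: ell_ge_mul => //; move: by_; rewrite yE ellD.
  have -> : y +o (p *o i +o r) = g +o (p *o (l' +o omega *o k +o i) +o r).
    by rewrite yE xE -pw -omulA !omulDr !oaddA.
  rewrite [X in _ < X]aE oadd_lt => lt; apply: H => //.
  rewrite ltNge; apply/negP => lq; move: lt; rewrite ltNge.
  by rewrite (le_trans (omul_leW _ lq))// le_oaddr.
move=> y z r gy gz sy sz rs; have [i [t [rE tp]]] := odiv_ex r p0.
by rewrite rE in rs *; rewrite !block.
Qed.

Lemma H0_tame Omega (X : set (Below Omega)) : H0 Omega X -> tame (\val @` X).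
Proof.
move=> hX a aL; have [aO|Oa] := leP a Omega.
  have : is_limit a by apply/limit_ell; exact: limit_gt0.
  by move=> /hX/(_ aO)/up_inP[g [p [l R]]]; exact: repeats_tame R.
(* Here [Omega] is below [a], and the set has no elements beyond [Omega]. *)
exists Omega, ozero; split=> //; first exact: limit_gt0.
have nX b r : Omega < b -> ~ (\val @` X) (b +o r).
  move=> Ob [x _ xE]; have := valP x; rewrite /= xE ltNge.
  by rewrite (le_trans (ltW Ob))// le_oaddr.
by move=> b c r /andP[/nX Ob _] /andP[/nX Oc _] _ _ _; split=> [/Ob|/Oc].
Qed.

Lemma Vfam_good n Omega X : Vfam n Omega X -> good (\val @` X).
Proof.
elim: n X => [|n IH] X; first by move=> /H0_tame/good_base.
move=> [B [A [hB vA ->]]].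
have -> : \val @` (B `&` ell_preimage A) = (\val @` B) `&` [set a | (\val @` A) (ell a)].
  apply/seteqP; split=> a; first by move=> [x [Bx Ax] <-]; split=> //; exists x.
  by move=> [[x Bx <-] Ax]; exists x.
by apply: good_and; [exact/good_base/H0_tame|exact/good_ell/IH].
Qed.

Lemma Hfam_good n Omega X : Hfam n Omega X -> good (\val @` X).
Proof.
case: n => [|n]; first exact: (@Vfam_good 0).
have sub : smallest setU_closed (Vfam n.+1 Omega) `<=` [set Y | good (\val @` Y)].
  apply: smallest_sub; last exact: Vfam_good.
  by move=> A B gA gB; rewrite /= image_setU; exact: good_or.
exact: sub.
Qed.

Lemma GLP_sound Omega (v : nat -> set (Below Omega)) f :
  (forall p, (\bigcup_n Hfam n Omega) (v p)) -> GLP f ->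
  interp (derivative Omega) v f = setT.
Proof.
move=> vH Gf; apply/seteqP; split=> // x _; apply/interp_sat.
by apply: GLP_sat => // p; have [n _] := vH p; exact: Hfam_good.
Qed.

(** * The canonical model *)

HB.instance Definition _ := gen_eqMixin form.

(** * Derivability from finite lists of hypotheses *)

Definition derives (L : seq form) (f : form) : Prop := GLP (foldr Imp f L).

Lemma bool_eval_imps h L f :
  bool_eval h (foldr Imp f L) = (all (bool_eval h) L ==> bool_eval h f).
Proof. by elim: L => //= g L ->; case: bool_eval. Qed.

Lemma GLP_imps L f : derives L f -> (forall g, g \in L -> GLP g) -> GLP f.
Proof.
rewrite /derives; elim: L => //= g L IH H GL; apply: IH.
  by apply: GLP_mp H _; apply: GL; rewrite mem_head.
by move=> k kL; apply: GL; rewrite in_cons kL orbT.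
Qed.

Lemma derives_taut L f : (forall h, all (bool_eval h) L -> bool_eval h f) -> derives L f.
Proof. by move=> H; apply: GLP_taut => h; rewrite bool_eval_imps; apply/implyP; exact: H. Qed.

Lemma GLP_tautcons L f : (forall h, all (bool_eval h) L -> bool_eval h f) ->
  (forall g, g \in L -> GLP g) -> GLP f.
Proof. by move=> /derives_taut; exact: GLP_imps. Qed.

Lemma derives_cut L M f : derives M f -> (forall g, g \in M -> derives L g) -> derives L f.
Proof.
move=> Mf LM; apply: (@GLP_tautcons (foldr Imp f M :: [seq foldr Imp g L | g <- M])).
  move=> h /= /andP[]; rewrite !bool_eval_imps => /implyP Hf HM.
  apply/implyP => HL; apply: Hf; apply/allP => g gM.
  move/allP: HM => /(_ (foldr Imp g L)); rewrite bool_eval_imps HL /=.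
  by apply; apply/mapP; exists g.
by move=> g; rewrite in_cons => /predU1P[->//|/mapP[k kM ->]]; exact: LM.
Qed.

Lemma derives_in L f : f \in L -> derives L f.
Proof. by move=> fL; apply: derives_taut => h /allP; apply. Qed.

Lemma derives_sub L M f : {subset L <= M} -> derives L f -> derives M f.
Proof. by move=> LM Lf; apply: derives_cut Lf _ => g /LM/derives_in. Qed.

Lemma derives1 L f g : GLP (Imp f g) -> derives L f -> derives L g.
Proof.
move=> fg Lf; apply: (@derives_cut L [:: f]); first exact: fg.
by move=> k; rewrite inE => /eqP ->.
Qed.

Lemma GLP_trans f g k : GLP (Imp f g) -> GLP (Imp g k) -> GLP (Imp f k).
Proof. by move=> fg gk; apply: (@derives1 [:: f] g k). Qed.

Lemma GLP_box_imp n f g : GLP (Imp f g) -> GLP (Imp (Box n f) (Box n g)).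
Proof. by move=> H; apply: GLP_mp (GLP_K _ _ _) _; exact: GLP_nec. Qed.

Lemma derives_box n L f : derives L f -> derives (map (Box n) L) (Box n f).
Proof.
rewrite /derives; elim: L f => [|g L IH] f /=; first exact: GLP_nec.
move=> /(GLP_box_imp n) H; apply: GLP_trans H _.
elim: L {IH} => [|k L IH] /=; first by apply: GLP_taut => h; exact: implybb.
apply: GLP_trans (GLP_K _ _ _) _.
apply: (@GLP_tautcons [:: Imp (Box n (foldr Imp f L)) (foldr Imp (Box n f) (map (Box n) L))]).
  by move=> h /=; rewrite andbT; case: (h (Box n k)); case: (h (Box n _)); case: bool_eval.
by move=> q; rewrite inE => /eqP ->.
Qed.

(** Löb's axiom for [c], the conjunction of [f] and [Box n f]: since [Box n c] implies [Box n f],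
    the formula [f] implies [Imp (Box n c) c]. *)
Lemma GLP_4 n f : GLP (Imp (Box n f) (Box n (Box n f))).
Proof.
pose c := Neg (Imp f (Neg (Box n f))).
have cf : GLP (Imp (Box n c) (Box n f)).
  by apply: GLP_box_imp; apply: GLP_taut => h; rewrite /c /=; case: bool_eval; case: (h _).
have cb : GLP (Imp (Box n c) (Box n (Box n f))).
  by apply: GLP_box_imp; apply: GLP_taut => h; rewrite /c /=; case: bool_eval; case: (h _).
apply: GLP_trans cb; apply: GLP_trans (GLP_Lob n c); apply: GLP_box_imp.
apply: (@GLP_tautcons [:: Imp (Box n c) (Box n f)]).
  by move=> h; rewrite /c /= andbT; case: bool_eval; case: (h _); case: (h _).
by move=> q; rewrite inE => /eqP ->.
Qed.

Lemma GLP_4lt m n f : (m < n)%N -> GLP (Imp (Box m f) (Box n (Box m f))).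
Proof. by move=> mn; apply: GLP_trans (GLP_4 m f) _; apply: GLP_mono; exact: ltnW. Qed.

Lemma GLP_neg_box m n f : (m < n)%N -> GLP (Imp (Neg (Box m f)) (Box n (Neg (Box m f)))).
Proof.
move=> mn.
have nn g k : GLP (Imp g k) -> GLP (Imp (Neg k) (Neg g)).
  move=> gk; apply: (@GLP_tautcons [:: Imp g k]); last by move=> q; rewrite inE => /eqP ->.
  by move=> h /=; rewrite andbT !implybF; case: bool_eval; case: bool_eval.
have e1 : GLP (Imp (Neg (Box m f)) (Dia m (Neg f))).
  by apply/nn/GLP_box_imp; apply: GLP_taut => h /=; case: bool_eval.
have e2 : GLP (Imp (Dia m (Neg f)) (Neg (Box m f))).
  by apply/nn/GLP_box_imp; apply: GLP_taut => h /=; case: bool_eval.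
apply: GLP_trans e1 _; apply: GLP_trans (GLP_neg (Neg f) mn) _; exact: GLP_box_imp.
Qed.

(** * The finite canonical frame over an adequate set of formulas *)

Section canonical.
Variables (N : nat) (G : seq form).
Hypothesis GI : forall f g, Imp f g \in G -> f \in G /\ g \in G.
(** Closure under the change of index lets the monotonicity axiom act inside [G]; see
    [holds_mono]. *)
Hypothesis GB : forall m f, Box m f \in G ->
  [/\ (m <= N)%N, f \in G & forall j, (j <= N)%N -> Box j f \in G].

(** Every truth assignment to the members of [G] is a state, which makes the type finite;
    consistency is a separate predicate. *)
Definition state := (size G).-tuple bool.
Implicit Types x y z : state.

Definition holds x f := (f \in G) && nth false x (index f G).

Lemma holdsG x f : holds x f -> f \in G. Proof. by case/andP. Qed.

Definition lit x f := if holds x f then f else Neg f.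

Definition char x : seq form := map (lit x) G.

Definition consistent x := ~ derives (char x) Bot.

(** Every boolean evaluation agrees with the literals of some state, and there are finitely many
    states: if [L] were inconsistent with each of them, it would be inconsistent. *)
Lemma lindenbaum L : ~ derives L Bot -> exists x, ~ derives (L ++ char x) Bot.
Proof.
move=> nL; apply: contrapT => nE; apply: nL.
apply: (@GLP_tautcons [seq foldr Imp Bot (L ++ char x) | x <- enum {: state}]).
  move=> h /allP H; rewrite bool_eval_imps implybF; apply/negP => hL.
  pose x : state := map_tuple (bool_eval h) (in_tuple G).
  have := H (foldr Imp Bot (L ++ char x)).
  rewrite bool_eval_imps all_cat hL implybF => /(_ _)/negP -[].
    by apply/mapP; exists x => //; rewrite mem_enum.
  apply/allP => _ /mapP[f fG ->]; rewrite /lit /holds fG /=.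
  by rewrite (nth_map Bot) ?index_mem// nth_index//; case: ifP => //= ->.
move=> g /mapP[x _ ->]; apply: contrapT => nx; apply: nE; by exists x.
Qed.

Lemma char_holds x f : holds x f -> f \in char x.
Proof. by move=> xf; apply/mapP; exists f; rewrite /lit ?xf// (holdsG xf). Qed.

Lemma char_nholds x f : f \in G -> ~~ holds x f -> Neg f \in char x.
Proof. by move=> fG /negbTE xf; apply/mapP; exists f; rewrite /lit ?xf. Qed.

Lemma derives_holds x f : consistent x -> f \in G -> derives (char x) f -> holds x f.
Proof.
move=> cx fG xf; apply: contrapT => /negP nf; apply: cx.
apply: (@derives_cut _ [:: f; Neg f]); first by apply: GLP_taut => h /=; case: bool_eval.
move=> g; rewrite !inE => /predU1P[->//|/eqP ->]; exact/derives_in/char_nholds.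
Qed.

Lemma derives_nholds x f : consistent x -> derives (char x) (Neg f) -> ~~ holds x f.
Proof.
move=> cx xf; apply/negP => hf; apply: cx.
apply: (@derives_cut _ [:: f; Neg f]); first by apply: GLP_taut => h /=; case: bool_eval.
move=> g; rewrite !inE => /predU1P[->|/eqP -> //]; exact/derives_in/char_holds.
Qed.

Lemma holds_Bot x : consistent x -> holds x Bot = false.
Proof.
move=> cx; apply/negbTE/derives_nholds => //.
by apply: derives_taut => h.
Qed.

Lemma holds_Imp x f g : consistent x -> Imp f g \in G ->
  holds x (Imp f g) = (holds x f ==> holds x g).
Proof.
move=> cx ifg; have [fG gG] := GI ifg.
apply/idP/implyP => [xi xf|H].
  apply: derives_holds => //; apply: (@derives_cut _ [:: Imp f g; f]).
    by apply: GLP_taut => h /=; exact: implybb.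
  move=> k; rewrite !inE => /predU1P[->|/eqP ->]; exact/derives_in/char_holds.
apply: derives_holds => //.
have [xf|xf] := boolP (holds x f).
  apply: (derives1 (f := g)); first by apply: GLP_taut => h /=; do 2 case: bool_eval.
  exact/derives_in/char_holds/H.
apply: (derives1 (f := Neg f)); first by apply: GLP_taut => h /=; do 2 case: bool_eval.
exact/derives_in/char_nholds.
Qed.

Lemma holds_mono x m j f : consistent x -> (m <= j)%N -> (j <= N)%N ->
  holds x (Box m f) -> holds x (Box j f).
Proof.
move=> cx mj jN xf; have [_ _ /(_ _ jN) jG] := GB (holdsG xf).
apply: derives_holds => //; apply: (derives1 (GLP_mono f mj)).
exact/derives_in/char_holds.
Qed.

(** The last clause gives irreflexivity. As lower boxes agree, relations of different index are
    disjoint: monotonicity of boxes is carried by the states, not by inclusions between the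
    relations. *)
Definition R (j : nat) x y : Prop :=
  [/\ forall f, holds x (Box j f) -> holds y f /\ holds y (Box j f),
      forall m f, (m < j)%N -> holds x (Box m f) = holds y (Box m f) &
      exists f, holds y (Box j f) /\ ~~ holds x (Box j f)].

(** From [x] the [k]-box of each demand in [D] is derivable. If [D] were inconsistent with [Box k f]
    and [Neg f], then [x] would derive [Box k (Imp (Box k f) f)], and so [Box k f] by Löb's
    axiom. *)
Lemma R_exists x k f : consistent x -> Box k f \in G -> ~~ holds x (Box k f) ->
  exists y, [/\ consistent y, R k x y & ~~ holds y f].
Proof.
move=> cx kG nx; have [kN fG _] := GB kG.
(* What the member [g] of [G] contributes to the first two clauses of [R k x y]. *)
pose hyps g := if g is Box m q then
    if holds x g then
      (if m == k then [:: q; Box k q] else [::]) ++ (if (m < k)%N then [:: Box m q] else [::])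
    else if (m < k)%N then [:: Neg (Box m q)] else [::]
  else [::].
pose D := flatten (map hyps G).
have inD q g : q \in hyps g -> g \in G -> q \in D.
  by move=> qg gG; apply/flattenP; exists (hyps g) => //; exact: map_f.
have /lindenbaum[y ny] : ~ derives (Neg f :: Box k f :: D) Bot.
  move=> inc; move/negP: nx; apply; apply: derives_holds => //.
  have Dk : derives D (Imp (Box k f) f).
    apply: (@GLP_tautcons [:: foldr Imp Bot (Neg f :: Box k f :: D)]).
      move=> h; rewrite all_seq1 !bool_eval_imps /=.
      by case: all; case: (h (Box k f)); case: bool_eval.
    by move=> q; rewrite inE => /eqP ->.
  have := derives_box k Dk; move=> /(derives1 (GLP_Lob k f)).
  move=> /derives_cut; apply=> _ /mapP[d /flattenP[_ /mapP[g gG ->]] dg ->].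
  case: g gG dg => // m q gG; rewrite /hyps; case: ifP => [xq|/negbT xq].
    rewrite mem_cat; have xin := derives_in (char_holds xq) => /orP[].
      case: eqP xin => // -> xin; rewrite !inE => /predU1P[->//|/eqP ->].
      exact: derives1 (GLP_4 k q) xin.
    case: ltnP => // mk; rewrite inE => /eqP ->.
    exact: derives1 (GLP_4lt q mk) xin.
  case: ltnP => // mk; rewrite inE => /eqP ->.
  apply: derives1 (GLP_neg_box q mk) _; exact/derives_in/char_nholds.
set L := _ :: _ in ny.
have cy : consistent y.
  move=> yB; apply: ny; apply: derives_sub yB => q qy; by rewrite mem_cat qy orbT.
have inL q : q \in G -> q \in L -> holds y q.
  move=> qG qL; apply: contrapT => /negP nq; apply: ny.
  apply: (@derives_cut _ [:: q; Neg q]); first by apply: GLP_taut => h /=; case: bool_eval.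
  move=> g; rewrite !inE => /predU1P[->|/eqP ->]; apply: derives_in; rewrite mem_cat ?qL//.
  by rewrite char_nholds// orbT.
have ninL q : Neg q \in L -> ~~ holds y q.
  move=> qL; apply/negP => nq; apply: ny.
  apply: (@derives_cut _ [:: q; Neg q]); first by apply: GLP_taut => h /=; case: bool_eval.
  move=> g; rewrite !inE => /predU1P[->|/eqP ->]; apply: derives_in; rewrite mem_cat ?qL//.
  by rewrite char_holds// orbT.
have DL q : q \in D -> q \in L by move=> qD; rewrite !inE qD !orbT.
exists y; split=> //; last by apply: ninL; rewrite mem_head.
split.
- move=> q xq; have qG := holdsG xq; have [_ qG' _] := GB qG.
  by split; apply: inL => //; apply: DL; apply: inD qG; rewrite /hyps xq eqxx !inE eqxx ?orbT.
- move=> m q mk; have [qG|qG] := boolP (Box m q \in G); last first.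
    by rewrite /holds (negbTE qG).
  have [xq|xq] := boolP (holds x (Box m q)).
    by apply/esym/inL => //; apply: DL; apply: inD qG; rewrite /hyps xq mk mem_cat mem_head orbT.
  apply/esym/negbTE/ninL; apply: DL; apply: inD qG.
  by rewrite /hyps (negbTE xq) mk mem_head.
- by exists f; split=> //; apply: inL => //; rewrite !inE eqxx orbT.
Qed.

Lemma R_irr j x : ~ R j x x.
Proof. by case=> _ _ [f [->]]. Qed.

(** When [i < j], what [x] boxes with [i] is boxed with [i] in [y], by monotonicity also with [j],
    and so holds in [z]. This makes the union [Rge] transitive. *)
Lemma R_trans i j x y z : consistent y -> (j <= N)%N ->
  R i x y -> R j y z -> R (minn i j) x z.
Proof.
move=> cy jN [b1 a1 [f [yf xf]]] [b2 a2 [g [zg yg]]].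
have [ij|ji|ij] := ltngtP i j.
- split.
  + move=> q /b1[_ yq]; split; last by rewrite -a2.
    by have [] := b2 q (holds_mono cy (ltnW ij) jN yq).
  + by move=> m q mi; rewrite a1// a2// (ltn_trans mi).
  + by exists f; rewrite -a2.
- split.
  + by move=> q; rewrite a1//; exact: b2.
  + by move=> m q mj; rewrite a1 ?a2// (ltn_trans mj).
  + by exists g; rewrite a1.
- rewrite -ij in b2 a2 zg yg *; split.
  + by move=> q /b1[_ /b2].
  + by move=> m q mi; rewrite a1// a2.
  + by exists f; split=> //; have [] := b2 f yf.
Qed.

Definition Rge (k : nat) x y : Prop :=
  consistent y /\ exists j, [/\ (k <= j)%N, (j <= N)%N & R j x y].

Lemma Rge_trans k x y z : Rge k x y -> Rge k y z -> Rge k x z.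
Proof.
move=> [cy [i [ki iN xy]]] [cz [j [kj jN yz]]]; split=> //.
exists (minn i j); split; [by rewrite leq_min ki|by rewrite geq_min iN|].
exact: R_trans yz.
Qed.

Lemma Rge_irr k x : ~ Rge k x x.
Proof. by move=> [_ [j [_ _ /R_irr]]]. Qed.

Lemma Rge_mono k k' x y : (k <= k')%N -> Rge k' x y -> Rge k x y.
Proof.
move=> kk [cy [j [kj jN xy]]]; split=> //; exists j; split=> //; exact: leq_trans kj.
Qed.

Lemma Rge_box k j x y f : consistent x -> (j <= k)%N -> (k <= N)%N -> Rge k x y ->
  holds x (Box j f) -> holds y f.
Proof.
move=> cx jk kN [cy [i [ki iN [b _ _]]]] xf.
by have [] := b f (holds_mono cx (leq_trans jk ki) iN xf).
Qed.

Lemma Rge_agree k m x y f : (m < k)%N -> Rge k x y ->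
  holds x (Box m f) = holds y (Box m f).
Proof. by move=> mk [_ [j [kj _ [_ a _]]]]; apply: a; exact: leq_trans kj. Qed.

(** The relation is transitive and irreflexive on a finite type, so the number of successors
    decreases along it. *)
Lemma Rge_ind k (P : state -> Prop) :
  (forall x, (forall y, Rge k x y -> P y) -> P x) -> forall x, P x.
Proof.
move=> H x; have [n] := ubnP #|[pred y : state | `[< Rge k x y >]]|.
elim: n x => // n IH x; rewrite ltnS => xn; apply: H => y xy; apply: IH.
apply: leq_trans xn; apply: proper_card; apply/properP; split.
  apply/fintype.subsetP => z; rewrite !inE => yz.
  exact: Rge_trans xy yz.
by exists y; rewrite !inE /= ?asboolE //; apply/asboolPn; exact: Rge_irr.
Qed.

End canonical.

(** * Closure under subformulas and under the change of box index *)

Fixpoint subforms (f : form) : seq form :=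
  f :: match f with
       | Imp g k => subforms g ++ subforms k
       | Box _ g => subforms g
       | _ => [::]
       end.

Definition box_closure (N : nat) (f : form) : seq form :=
  subforms f ++
  flatten [seq if g is Box _ h then [seq Box j h | j <- iota 0 N.+1] else [::] | g <- subforms f].

Lemma subforms_refl f : f \in subforms f.
Proof. by case: f => *; rewrite /= mem_head. Qed.

Lemma subforms_trans f g k : f \in subforms g -> g \in subforms k -> f \in subforms k.
Proof.
move=> fg; elim: k => [p||k1 IH1 k2 IH2|n k IH] /=; rewrite in_cons.
- by case/predU1P => // gk; rewrite gk in fg.
- by case/predU1P => // gk; rewrite gk in fg.
- case/predU1P => [gk|]; first by rewrite gk in fg.
  by rewrite mem_cat => /orP[/IH1|/IH2] H; rewrite in_cons mem_cat H ?orbT.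
- case/predU1P => [gk|/IH H]; first by rewrite gk in fg.
  by rewrite in_cons H orbT.
Qed.

Lemma box_closure_Imp N f g k : Imp g k \in box_closure N f ->
  g \in box_closure N f /\ k \in box_closure N f.
Proof.
rewrite !mem_cat => /orP[gk|/flattenP[_ /mapP[q _ ->]]]; last first.
  by case: q => // m h /mapP[].
by split; apply/orP; left; apply: subforms_trans gk;
  rewrite /= in_cons mem_cat subforms_refl ?orbT.
Qed.

Lemma language_subforms I f g : language I f -> g \in subforms f -> language I g.
Proof.
elim: f => [p||f1 IH1 f2 IH2|n f IH] lf /=; rewrite in_cons.
- by case/predU1P => // ->.
- by case/predU1P => // ->.
- case: (lf) => l1 l2 /predU1P[->//|].
  by rewrite mem_cat => /orP[/(IH1 l1)|/(IH2 l2)].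
- by case: (lf) => In l /predU1P[->//|/(IH l)].
Qed.

Lemma box_closure_Box N f m g : language (upto N) f -> Box m g \in box_closure N f ->
  [/\ (m <= N)%N, g \in box_closure N f & forall j, (j <= N)%N -> Box j g \in box_closure N f].
Proof.
move=> lf mg; suff [i ig mN] : exists2 i, Box i g \in subforms f & (m <= N)%N.
  split=> // [|j jN]; rewrite mem_cat; apply/orP.
    by left; apply: subforms_trans ig; rewrite /= in_cons subforms_refl orbT.
  right; apply/flattenP; exists [seq Box j g | j <- iota 0 N.+1].
    by apply/mapP; exists (Box i g).
  by apply/mapP; exists j => //; rewrite mem_iota.
move: mg; rewrite mem_cat => /orP[mg|/flattenP[_ /mapP[q qf ->]]].
  by exists m => //; have [] := language_subforms lf mg.
case: q qf => // i h ih /mapP[j]; by rewrite mem_iota => /andP[_ jN] [-> ->]; exists i.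
Qed.

(** * Labellings by hereditarily periodic colourings *)

Section colourings.
Variable T : Type.
Implicit Type c : Ord -> T.

Definition hpc c : Prop := forall x, is_limit x -> exists g p l, repeats c x g p l.

Lemma repeats_const c x t : is_limit x -> (forall b, b < x -> c b = t) ->
  repeats c x ozero oone x.
Proof.
move=> xL ct; split=> //; first exact: ltSo.
  by rewrite add0o mul1o.
move=> q r qx; rewrite lt_osucc leNgt0 => /eqP ->.
by rewrite !ct// ?oadd0 ?limit_gt0// add0o mul1o.
Qed.

(** Moving the start by one period makes it positive; translation and concatenation control labels
    at positive positions only. *)
Lemma repeats_pos c x g p l : repeats c x g p l -> repeats c x (g +o p) p l.
Proof.
move=> [p0 lL xE H]; split=> //.
  by rewrite xE -oaddA -{2}(omul1 p) -omulDr one_limit.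
move=> q r ql rp; rewrite -!oaddA.
have e r' : p +o r' = p *o oone +o r' by rewrite omul1.
have l1 : oone < l by apply: (limit_succ lL); exact: limit_gt0.
rewrite [in RHS]e [RHS]H// (_ : p +o (p *o q +o r) = p *o (oone +o q) +o r).
  apply: H => //; rewrite -(one_limit lL) oadd_lt//.
by rewrite omulDr omul1 oaddA.
Qed.

Lemma repeats_lt c x g p l q r : repeats c x g p l -> q < l -> r < p ->
  g +o (p *o q +o r) < x.
Proof.
move=> [p0 lL -> _] ql rp; rewrite oadd_lt -(oadd0 (p *o l)); exact: odiv_lt.
Qed.

Lemma hpc_pos c x : hpc c -> is_limit x ->
  exists g p l, ozero < g /\ repeats c x g p l.
Proof.
move=> /[apply] -[g [p [l R]]]; exists (g +o p), p, l; split; last exact: repeats_pos.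
by case: R => p0 _ _ _; rewrite (lt_le_trans p0)// le_oaddl.
Qed.

End colourings.

Lemma repeats_ext (T U : Type) (F : T -> U) (c : Ord -> T) (c' : Ord -> U) d x g p l :
  repeats c x g p l -> (forall b, g <= b < x -> c' (d +o b) = F (c b)) ->
  repeats c' (d +o x) (d +o g) p l.
Proof.
move=> R E; have [p0 lL xE H] := R; split=> //; first by rewrite {1}xE oaddA.
move=> q r ql rp; rewrite -!oaddA !E ?H ?le_oaddr ?(repeats_lt R)//.
have := repeats_lt R (limit_gt0 lL) rp; by rewrite omul0 add0o.
Qed.

(* The functional form of [Hfam m]: labellings in [Lv m.+1] have their fibres in it. *)
Fixpoint Lv (S : Type) (m : nat) (f : Ord -> S) : Prop :=
  if m is n.+1 then exists (c : Ord -> nat) (K : nat) (hs : nat -> Ord -> S),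
    [/\ hpc c, forall b, (c b < K)%N, forall j, Lv n (hs j) &
        forall b, f b = hs (c b) (ell b)]
  else exists s, forall b, f b = s.

Section labellings.
Variable S : Type.
Implicit Types f w : Ord -> S.

Lemma Lv_const m (s : S) : Lv m (fun _ => s).
Proof.
elim: m => [|m IH]; first by exists s.
exists (fun _ => 0%N), 1%N, (fun _ _ => s); split=> // x xL.
by exists ozero, oone, x; exact: (repeats_const xL (t := 0%N)).
Qed.

Lemma Lv_shift m f a : Lv m f ->
  exists2 f', Lv m f' & forall b, ozero < b -> f' (a +o b) = f b.
Proof.
case: m => [[s sE]|m [c [K [hs [hc cK hL fE]]]]]; first by exists f;
  [exists s|move=> b _; rewrite !sE].
exists (fun b => hs (c (osub b a)) (ell b)); last first.
  by move=> b b0; rewrite osubK ellD// fE.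
exists (fun b => c (osub b a)), K, hs; split=> // x xL.
have [xa|ax] := leP x a.
  (* Before the translated part [osub] takes its default value 0, so the colouring is constant
     there. *)
  exists ozero, oone, x; apply: (repeats_const xL (t := c ozero)) => b bx.
  by rewrite osub_lt0// (lt_le_trans bx).
have [d xE] := osub_ex (ltW ax).
have d0 : ozero < d by rewrite -(oadd_lt a) oadd0 -xE.
have [g [p [l R]]] := hc d (@limit_oadd a d (eq_ind _ _ xL _ xE) d0).
exists (a +o g), p, l; rewrite xE.
by apply: (repeats_ext (F := id) R) => b _; rewrite osubK.
Qed.

Lemma Lv_cat m w1 w2 a : Lv m.+1 w1 -> Lv m.+1 w2 ->
  exists f, [/\ Lv m.+1 f, forall b, b <= a -> f b = w1 b &
    forall b, ozero < b -> f (a +o b) = w2 b].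
Proof.
move=> [c1 [K1 [h1 [hc1 cK1 hL1 E1]]]] [c2 [K2 [h2 [hc2 cK2 hL2 E2]]]].
(* Raising the second colours by [K1] lets a colour tell which family of labellings to use. *)
pose c b := if b <= a then c1 b else (K1 + c2 (osub b a))%N.
pose h j := if (j < K1)%N then h1 j else h2 (j - K1)%N.
exists (fun b => h (c b) (ell b)); split; last 2 first.
- by move=> b ba; rewrite /c ba /h cK1 E1.
- move=> b b0; rewrite /c leNgt lt_oaddr//= /h ltnNge leq_addr /=.
  by rewrite addKn osubK ellD// E2.
exists c, (K1 + K2)%N, h; split=> //.
- move=> x xL; have [xa|ax] := leP x a.
    have [g [p [l R]]] := hc1 x xL.
    exists g, p, l; rewrite -(add0o x) -(add0o g).
    apply: (repeats_ext (F := id) R) => b /andP[_ bx].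
    by rewrite add0o /c ltW// (lt_le_trans bx).
  have [d xE] := osub_ex (ltW ax).
  have d0 : ozero < d by rewrite -(oadd_lt a) oadd0 -xE.
  have [g [p [l [g0 R]]]] := hpc_pos hc2 (@limit_oadd a d (eq_ind _ _ xL _ xE) d0).
  exists (a +o g), p, l; rewrite xE.
  apply: (repeats_ext (F := addn K1) R) => b /andP[gb _].
  by rewrite /c leNgt lt_oaddr ?osubK// (lt_le_trans g0).
- by move=> b; rewrite /c; case: ifP => _; rewrite ?ltn_add2l// ltn_addr.
- by move=> j; rewrite /h; case: ifP => _; [exact: hL1|exact: hL2].
Qed.

Lemma limit_omegaM k : ozero < k -> is_limit (omega *o k).
Proof.
move=> /cnf_last[c [b ->]]; rewrite omulDr; apply: oadd_limit.
have -> : omega = omega_pow oone by rewrite omega_powS omega_pow0 mul1o.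
by rewrite -omega_powD; apply: omega_pow_limit; rewrite (lt_le_trans (ltSo _))// le_oaddr.
Qed.

Lemma not_limit_add_onat d k : ~ is_limit (d +o onat k.+1).
Proof. by rewrite /= oaddS; exact: osucc_nlimit. Qed.

(** A copy of [w] runs from [p *o q] exclusive to [p *o osucc q] inclusive, which leaves free the
    points [p *o q] with [q] zero or a limit. At limits the new colour [K] selects [f'], the
    translate of [f] by [a], because the rank there is [a +o ell q]. *)
Lemma Lv_power m w f a p : omega_pow a <= p -> p < omega_pow (osucc a) ->
  Lv m.+1 w -> Lv m f ->
  exists F, [/\ Lv m.+1 F,
    forall q r, ozero < r -> r <= p -> F (p *o q +o r) = w r &
    forall q, is_limit q -> F (p *o q) = f (ell q)].
Proof.
move=> ap pa [cw [K [hw [hcw cwK hwL wE]]]] /(@Lv_shift _ _ a)[f' f'L f'E].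
have p0 : ozero < p by exact: lt_le_trans (omega_pow_gt0 a) ap.
pose col q r := if r != ozero then cw r else if `[< is_limit q >] then K else cw p.
have [c cE] : exists c, forall q r, r < p -> c (p *o q +o r) = col q r.
  have qr b : {z : Ord * Ord | b = p *o z.1 +o z.2 /\ z.2 < p}.
    by apply: cid; have [q [r H]] := odiv_ex b p0; exists (q, r).
  exists (fun b => let: z := projT1 (qr b) in col z.1 z.2) => q r rp.
  case: (qr _) => -[q' r'] /= [e r'p].
  by have [-> ->] := odiv_uniq rp r'p e.
have cE0 q : c (p *o q) = col q ozero by rewrite -[p *o q]oadd0 cE.
have c_pos q b : ozero < b -> b < p -> c (p *o q +o b) = cw b.
  by rewrite lt0_neq => b0 bp; rewrite cE// /col b0.
have c_succ q : c (p *o osucc q) = cw p.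
  by rewrite cE0 /col eqxx/=; case: asboolP => // /osucc_nlimit.
pose h j := if (j < K)%N then hw j else f'.
exists (fun b => h (c b) (ell b)); split; last 2 first.
- move=> q r r0; rewrite le_eqVlt => /predU1P[->|rp].
    by rewrite -omulS c_succ /h cwK omulS ellD// wE.
  by rewrite c_pos// /h cwK ellD// wE.
- move=> q qL; rewrite cE0 /col eqxx/=; case: asboolP => // _.
  rewrite /h ltnn (ell_mul_limit ap pa)// f'E//.
  exact/limit_ell.
exists c, K.+1, h; split=> //; last 2 first.
- by move=> b; have [q [r [-> rp]]] := odiv_ex b p0; rewrite cE// /col;
    case: ifP => _; [|case: ifP => _]; rewrite ltnS ?leqnn// ltnW.
- by move=> j; rewrite /h; case: ifP => _; [exact: hwL|exact: f'L].
move=> x xL.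
have block q r : is_limit r -> r <= p -> exists g s l, repeats c (p *o q +o r) g s l.
  move=> rL rp; have [g [s [l [g0 R]]]] := hpc_pos hcw rL.
  exists (p *o q +o g), s, l; apply: (repeats_ext (F := id) R) => b /andP[gb br].
  by rewrite c_pos// ?(lt_le_trans g0)// (lt_le_trans br).
have [q [r [xE rp]]] := odiv_ex x p0.
have [r0|] := eqVneq r ozero; last first.
  rewrite -lt0_neq => r0; rewrite xE; apply: block; last exact: ltW.
  by apply: (@limit_oadd (p *o q)) => //; rewrite -xE.
rewrite r0 oadd0 in xE; rewrite {}xE {r0 rp} in xL *.
case: (ord_case q) => [q0|[q' qE]|qL].
- by case: xL; rewrite q0 omul0 eqxx.
- rewrite qE omulS in xL *; apply: block => //.
  exact: limit_oadd xL p0.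
have colE d i : i < omega -> is_limit d ->
    is_limit (d +o i) <-> i = ozero.
  move=> /lt_omega[[|k] ->] dL; first by rewrite oadd0.
  split; first by move/not_limit_add_onat.
  by move=> /eqP; rewrite (negbTE (osucc_neq0 _)).
have [k k0 qE] := limit_omega qL.
(* For [k] the successor of [s], no relabelled point comes after index [omega *o s], and the period
   is [p]. For a limit [k] the period is [p *o omega], with one relabelled point at the start of
   each; the first period is skipped because index 0 is not a limit. *)
case: (ord_case k) => [k00|[s kE]|kL]; first by rewrite k00 ltxx in k0.
- exists (p *o (omega *o s +o oone)), p, omega; split=> //; first exact: omega_limit.
    by rewrite -omulDr -oaddA one_limit ?qE ?kE ?omulS//; exact: omega_limit.
  move=> _ t /lt_omega[i ->] tp; rewrite oaddA -omulDr !cE// /col.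
  case: ifP => // _; rewrite -oaddA (onatD 1 i) addn1.
  by rewrite (asboolF (@not_limit_add_onat _ i)) (asboolF (@not_limit_add_onat _ 0)).
- exists (p *o omega), (p *o omega), k; split=> //.
  + by apply: omul_gt0 => //; exact: omega_gt0.
  + by rewrite qE omulA -{2}(omul1 (p *o omega)) -omulDr one_limit.
  + move=> j t jk; have [i [u [-> up]]] := odiv_ex t p0 => iup.
    have io : i < omega.
      rewrite ltNge; apply/negP => oi; move: iup; rewrite ltNge.
      by rewrite (le_trans (omul_leW p oi))// le_oaddr.
    rewrite -!omulA !oaddA -!omulDr !cE// /col; case: ifP => // _.
    congr (if _ then _ else _); apply/asbool_equiv_eq.
    rewrite colE//; last first.
      rewrite -{1}(omul1 omega) -omulDr; apply: limit_omegaM.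
      by rewrite (lt_le_trans (ltSo _))// le_oaddr.
    by rewrite colE//; exact: omega_limit.
Qed.

Lemma trace_up_in (U : Type) (c : Ord -> U) (P : U -> Prop) Omega :
  hpc c -> H0 Omega [set x : Below Omega | P (c (\val x))].
Proof.
move=> hc x xL xO; have [g [p [l R]]] := hc x xL.
apply/up_inP; exists g, p, l; have [p0 lL xE H] := R; split=> // q r ql rp.
have tr b : b < x -> (\val @` [set y : Below Omega | P (c (\val y))]) b = P (c b).
  move=> bx; apply/propext; split=> [[y Py <-]//|Pb].
  by exists (exist _ b (lt_le_trans bx xO)).
rewrite !tr ?(repeats_lt R)// ?H//.
by have := repeats_lt R (limit_gt0 lL) rp; rewrite omul0 add0o.
Qed.

Lemma Vfam_set0 n Omega : Vfam n Omega set0.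
Proof.
have h0 : H0 Omega set0.
  have := @trace_up_in _ (fun _ => tt) (fun _ => False) Omega; apply=> x xL.
  by exists ozero, oone, x; exact: (repeats_const xL (t := tt)).
by elim: n => [//|n IH]; exists set0, set0; split=> //; rewrite set0I.
Qed.

(** [Vfam] takes preimages of members of [Vfam] only; preimage and intersection distribute over the
    unions leading to [Hfam]. *)
Lemma Hfam_ell n Omega B A : H0 Omega B -> Hfam n Omega A ->
  Hfam n.+1 Omega (B `&` ell_preimage A).
Proof.
move=> hB hA; have inV A' : Vfam n Omega A' -> Hfam n.+1 Omega (B `&` ell_preimage A').
  by move=> vA; apply: sub_gen_smallest; exists B, A'.
case: n hA inV => [|n] hA inV; first exact: inV.
have sub : smallest setU_closed (Vfam n.+1 Omega) `<=`
    [set A' | Hfam n.+2 Omega (B `&` ell_preimage A')].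
  apply: smallest_sub; last exact: inV.
  move=> A1 A2 H1 H2 M [MU MV].
  suff -> : B `&` ell_preimage (A1 `|` A2) =
      (B `&` ell_preimage A1) `|` (B `&` ell_preimage A2).
    by apply: (MU); [exact: (H1 M (conj MU MV))|exact: (H2 M (conj MU MV))].
  rewrite -setIUr; congr (_ `&` _).
  by apply/funext => x; rewrite /ell_preimage image_setU.
exact: sub.
Qed.

Lemma Lv_Hfam n Omega f (P : S -> Prop) : Lv n.+1 f ->
  Hfam n Omega [set x : Below Omega | P (f (\val x))].
Proof.
elim: n f P => [|n IH] f P [c [K [hs [hc cK hL fE]]]].
  (* The [hs j] are constant at this level, so the rank can be replaced by 0. *)
  have -> : [set x : Below Omega | P (f (\val x))] =
      [set x | P (hs (c (\val x)) ozero)].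
    apply/funext => x /=; rewrite fE; have [s hE] := hL (c (\val x)).
    by rewrite !hE.
  exact: (@trace_up_in _ c (fun j => P (hs j ozero))).
pose X k := [set x : Below Omega | (c (\val x) < k)%N /\ P (f (\val x))].
have -> : [set x : Below Omega | P (f (\val x))] = X K.
  by apply/seteqP; split=> x //= -[].
elim: K {cK} => [|k IHk].
  suff -> : X 0 = set0 by apply: sub_gen_smallest; exact: Vfam_set0.
  by apply/seteqP; split=> x // -[].
suff -> : X k.+1 = X k `|` ([set x : Below Omega | c (\val x) = k] `&`
    ell_preimage [set x : Below Omega | P (hs k (\val x))]).
  have H1 := Hfam_ell (@trace_up_in _ c (fun j => j = k) Omega hc) (IH _ P (hL k)).
  by move=> M [MU MV]; apply: (MU); [exact: (IHk M (conj MU MV))|exact: (H1 M (conj MU MV))].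
apply/seteqP; split=> x.
  move=> [/=]; rewrite ltnS leq_eqVlt => /predU1P[ck|ck] Px; last by left.
  right; split=> //; have h : ell (\val x) < Omega.
    by rewrite (le_lt_trans (ell_le _))//; exact: (valP x).
  by exists (exist (fun y : Ord => y < Omega) _ h) => //=; rewrite -ck -fE.
move=> [[ck Px]|[/= ck [y /= Py yx]]]; first by split=> //; exact: ltnW.
by rewrite /X /= ltnS fE ck -yx.
Qed.

End labellings.

(** * Completeness *)

Section completeness.
Variables (N : nat) (G : seq form).
Hypothesis GI : forall f g, Imp f g \in G -> f \in G /\ g \in G.
Hypothesis GB : forall m f, Box m f \in G ->
  [/\ (m <= N)%N, f \in G & forall j, (j <= N)%N -> Box j f \in G].

Local Notation state := (state G).
Local Notation R := (@R G).
Local Notation Rge := (@Rge N G).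
Implicit Types (x y z : state) (w : Ord -> state).

(* The boxes from [k] on are read in the topologies from [0] on. *)
Definition truthful_at (k : nat) w (xi : Ord) : Prop :=
  forall i f, (k <= i <= N)%N -> Box i f \in G ->
    holds (w xi) (Box i f) <-> pn (i - k) xi (fun b => holds (w b) f).

(** Truth at [d +o xi] depends only on labels strictly after [d], so it survives concatenation. *)
Lemma truthful_at_shift k w w' d xi : ozero < xi ->
  (forall b, ozero < b -> b <= xi -> w' (d +o b) = w b) ->
  truthful_at k w xi -> truthful_at k w' (d +o xi).
Proof.
move=> x0 E tw i f ki fG; rewrite E// tw// pnD//; apply: pn_eq_pos => // b b0 bx.
by rewrite E// ltW.
Qed.

(** Used with [m] the number of modalities from [k] to [N]. Each costs one exponential in length,
    whence the bound; at [m = N.+1] it is the [omega_tower N.+2] of the theorem. *)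
Definition model (m k : nat) x (a : Ord) w : Prop :=
  [/\ ozero < a < omega_tower m.+1, w a = x,
      forall b, ozero < b -> b < a -> Rge k x (w b),
      forall b, ozero < b -> b <= a -> truthful_at k w b & Lv m w].

Lemma model_concat m k x (zs : seq state) :
  (forall z, z \in zs -> Rge k x z /\ exists a w, model m.+1 k z a w) ->
  exists p w, [/\ p < omega_tower m.+2, Lv m.+1 w,
    forall b, ozero < b -> b <= p -> truthful_at k w b /\ Rge k x (w b) &
    forall z, z \in zs -> exists b, [/\ ozero < b, b <= p & w b = z]].
Proof.
elim: zs => [|z zs IH] H.
  exists ozero, (fun _ => x); split=> //.
  - exact/limit_gt0/omega_tower_limit.
  - exact: Lv_const.
  - by move=> b b0; rewrite leNgt b0.
have [xz [a [w1 [/andP[a0 aw] w1a w1R w1T w1L]]]] := H z (mem_head _ _).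
have [y yzs|p [w2 [pw w2L w2R w2S]]] := IH; first by apply: H; rewrite in_cons yzs orbT.
have [w [wL E1 E2]] := Lv_cat a w1L w2L.
exists (a +o p), w; split=> //.
- exact: omega_tower_add.
- move=> b b0; have [ba _|/[dup]/ltW/osub_ex[d ->]] := leP b a.
    split.
      rewrite -(add0o b); apply: truthful_at_shift (w1T _ b0 ba) => // c _ cb.
      by rewrite add0o E1// (le_trans cb).
    rewrite E1//; move: ba; rewrite le_eqVlt => /predU1P[->|ba]; first by rewrite w1a.
    exact: Rge_trans xz (w1R _ b0 ba).
  rewrite oadd_le -{1}(oadd0 a) oadd_lt => d0 dp; have [T2 R2] := w2R _ d0 dp.
  split; last by rewrite E2.
  by apply: truthful_at_shift T2 => // c c0 _; rewrite E2.
- move=> y; rewrite in_cons => /predU1P[->|/w2S[b [b0 bp wb]]].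
    by exists a; rewrite le_oaddr E1.
  exists (a +o b); rewrite oadd_le E2//; split=> //.
  by rewrite (lt_le_trans b0)// le_oaddl.
Qed.

Lemma model_power m k x p w a' f' : (k <= N)%N -> consistent x ->
  p < omega_tower m.+2 -> Lv m.+1 w -> ozero < p ->
  (forall b, ozero < b -> b <= p -> truthful_at k w b /\ Rge k x (w b)) ->
  (forall z, Rge k x z -> exists b, [/\ ozero < b, b <= p & w b = z]) ->
  model m k.+1 x a' f' ->
  exists a F, model m.+1 k x a F.
Proof.
move=> kN cx pm wL p0 wT wS [/andP[a'0 a'm] f'a f'R f'T f'L].
have [a [ap pa]] := omega_log p0.
have [F [FL FB Fl]] := Lv_power ap pa wL f'L.
have tL := omega_pow_limit a'0.
pose K := p *o omega_pow a'.
have K0 : ozero < K by rewrite omul_gt0// omega_pow_gt0.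
have cases b : ozero < b -> b <= K ->
    (exists q r, [/\ b = p *o q +o r, ozero < r & r <= p]) \/
    (exists q, [/\ b = p *o q, is_limit q & q <= omega_pow a']).
  move=> b0 bK; have [q [r [bE rp]]] := odiv_ex b p0.
  have [r0|] := eqVneq r ozero; last first.
    by rewrite -lt0_neq => r0; left; exists q, r; rewrite ltW.
  rewrite r0 oadd0 in bE; case: (ord_case q) => [q0|[q' qE]|qL].
  - by rewrite bE q0 omul0 ltxx in b0.
  - by left; exists q', p; rewrite -omulS -qE.
  - by right; exists q; split=> //; rewrite -(omul_le _ _ p0) -bE.
(* Only the last point has [ell q = a']; smaller ranks carry labels above [x]. *)
have f'x q : is_limit q -> q <= omega_pow a' ->
    q = omega_pow a' \/ Rge k.+1 x (f' (ell q)).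
  move=> qL; rewrite le_eqVlt => /predU1P[->|qa]; [by left|right].
  by apply: f'R; [exact/limit_ell|apply: ell_lt_pow => //; exact: limit_gt0].
have FK : F K = x by rewrite Fl// ell_pow.
have FR b : ozero < b -> b < K -> Rge k x (F b).
  move=> b0 bK; case: (cases b b0 (ltW bK)) => [[q [r [bE r0 rp]]]|[q [bE qL qa]]].
    by rewrite bE FB//; have [] := wT r r0 rp.
  rewrite bE Fl//; case: (f'x q qL qa) => [qE|]; last exact: Rge_mono.
  by rewrite bE qE ltxx in bK.
exists K, F; split=> //.
  by rewrite K0 /= omega_tower_mul//; apply: omega_pow_ltr.
move=> b b0 bK; case: (cases b b0 bK) => [[q [r [-> r0 rp]]]|[q [bE qL qa]]].
  apply: truthful_at_shift (proj1 (wT r r0 rp)) => // c c0 cr.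
  by rewrite FB// (le_trans cr).
have lq : ell b = a +o ell q by rewrite bE (ell_mul_limit ap pa).
have eta0 : ozero < ell q by exact/limit_ell.
have etaa : ell q <= a'.
  by move: qa; rewrite le_eqVlt => /predU1P[->|/ell_lt_pow/ltW]; [rewrite ell_pow|
    apply; exact: limit_gt0].
move=> i g /andP[ki iN] gG; have Fb : F b = f' (ell q) by rewrite bE Fl.
(* Boxes of index [k] first: at relabelled points they have the same value as in [x], because
   [Rge k.+1] preserves them. *)
move: ki; rewrite leq_eqVlt => /predU1P[ik|ki].
  rewrite -ik in gG iN *; rewrite subnn Fb.
  have -> : holds (f' (ell q)) (Box k g) = holds x (Box k g).
    by case: (f'x q qL qa) => [->|/Rge_agree->//]; rewrite ell_pow f'a.
  split=> [xg|/pn0P].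
    suff : pn 0 b [set c | ozero < iter 0 ell c].
      apply: pnW => c cb /= c0; apply: (Rge_box GB cx (leqnn k) kN _ xg).
      by apply: FR => //; exact: lt_le_trans bK.
    by apply: pn_cyl => //; exact: cyl_gt.
  (* If [x] fails [Box k g], an [R k]-successor refutes [g]; it occurs in [w], whose copies are
     cofinal below [p *o q]. *)
  rewrite -lt0_neq b0 => /(_ isT)[h hb hU]; apply: contrapT => /negP nx.
  have [y [cy xy ny]] := R_exists GB cx gG nx.
  have [|c [c0 cp cE]] := wS y; first by split=> //; exists k; rewrite leqnn.
  move: hb; rewrite bE => /lt_omulL -/(_ qL)[u uq hu].
  move/negP: ny; apply; have := hU (p *o u +o c).
  rewrite FB// cE; apply; rewrite (lt_le_trans hu) ?le_oaddr//= bE.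
  (* Two more copies make the inequality strict, as [c] may equal [p]. *)
  apply: lt_le_trans (_ : p *o osucc (osucc u) <= _); last first.
    by rewrite omul_leW// ltW//; do 2 apply: limit_succ => //.
  by rewrite !omulS; apply: le_lt_trans (_ : p *o u +o p < _); rewrite ?oadd_le// lt_oaddr.
(* Higher boxes are read at the rank, where [f'] is truthful for them with the topology index
   lowered by one. *)
rewrite Fb (f'T _ eta0 etaa)// ?ki//; have -> : (i - k = (i - k.+1).+1)%N by rewrite -subSn.
set j := (i - k.+1)%N; split=> [pU|/pnSP[V [pV]]].
  have pV : pn j (ell b) [set e | exists z : Ord, [/\ ozero < z, e = a +o z & holds (f' z) g]].
    rewrite lq; apply/pnD => //; move: pU; apply: (pn_eq_pos _ eta0 _).1 => z z0 _ /=.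
    by split=> [hz|[z' [_ /oaddI <-]]//]; exists z.
  apply: pnW (pnS_ell pV) => c cb [z [z0 cz hz]].
  have c0 : ozero < c.
    rewrite lt0_neq; apply/eqP => c0; move: cz; rewrite c0 ell0 => /eqP.
    by rewrite lt_eqF// (lt_le_trans z0)// le_oaddl.
  case: (cases c c0 (ltW (lt_le_trans cb bK))) => [[q' [r [cE r0 rp]]]|[q' [cE q'L _]]].
    (* Inside a copy of [w] ranks are at most [a], but [c] has rank [a +o z] with [z] positive; so
       [c] is a relabelled point. *)
    have := ell_lt_pow r0 (le_lt_trans rp pa); rewrite lt_osucc leNgt.
    by rewrite -(ellD (p *o q') r0) -cE cz lt_oaddr.
  move: cz; rewrite cE (ell_mul_limit ap pa)// => /oaddI zE.
  by rewrite Fl// zE.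
rewrite -lt0_neq b0 => /(_ isT)[h hb hU].
move: pV; rewrite lq => /pnD -/(_ eta0) pV.
have pz : pn j (ell q) [set e | ozero < iter 0 ell e] by apply: pn_cyl => //; exact: cyl_gt.
apply: pnW (pnI pV pz) => z zq [/= Vz z0].
move: (hb); rewrite bE => /lt_omulL -/(_ qL)[u uq hu].
(* Each rank [z] in the neighbourhood of [ell q] is taken by limits [q'] close to [q], so that
   [p *o q'] tests [g] at [f' z]. *)
have [q' /andP[uq' q'q] q'z] := ell_cofinal zq uq.
have q'L : is_limit q' by apply/limit_ell; rewrite q'z.
have := hU (p *o q'); rewrite Fl// (ell_mul_limit ap pa)// q'z; apply=> //.
rewrite bE omul_lt// q'q andbT (lt_le_trans hu)// omul_leW// ltW//.
Qed.

Lemma model_exists m x : (m <= N.+1)%N -> consistent x ->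
  exists a w, model m (N.+1 - m) x a w.
Proof.
elim: m x => [|m IHm] x mN cx.
  (* No boxes are left to read, so one labelled point is enough. *)
  exists oone, (fun _ => x); split=> //; last exact: Lv_const.
  - rewrite ltSo /=; apply: limit_succ; first exact: (omega_tower_limit 0).
    exact/limit_gt0/(omega_tower_limit 0).
  - by move=> b b0; rewrite lt_osucc leNgt b0.
  - by move=> b _ _ i f /andP[]; rewrite subn0 => iN Ni; rewrite leqNgt iN in Ni.
rewrite subSS; have kN : (N - m <= N)%N by exact: leq_subr.
have kS : (N.+1 - m = (N - m).+1)%N by rewrite subSn.
move: (N - m)%N kN kS => k kN kS.
elim/(@Rge_ind N G GB k): x cx => x IHx cx.
have [[y0 xy0]|none] := pselect (exists y, Rge k x y); last first.
  (* The point 1 is isolated, which makes all boxes true; they hold in [x] too, since a failing one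
     would give a successor. *)
  exists oone, (fun _ => x); split=> //; last exact: Lv_const.
  - rewrite ltSo /=; apply: limit_succ; first exact: (omega_tower_limit m.+1).
    exact/limit_gt0/(omega_tower_limit m.+1).
  - by move=> b b0; rewrite lt_osucc leNgt b0.
  - move=> b b0; rewrite le_eqVlt lt_osucc leNgt b0 orbF => /eqP -> i f /andP[ki iN] fG.
    split=> _; first exact/pn_nlimit/osucc_nlimit.
    apply: contrapT => /negP nx; apply: none.
    have [y [cy xy _]] := R_exists GB cx fG nx.
    by exists y; split=> //; exists i.
pose zs := [seq y <- enum {: state} | `[< Rge k x y >]].
have zsP y : (y \in zs) = `[< Rge k x y >] by rewrite mem_filter mem_enum andbT.
have [|p [w [pw wL wR wS]]] := @model_concat m k x zs.
  move=> z; rewrite zsP => /asboolP xz; split=> //; apply: IHx => //.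
  by case: xz.
have {}wS z : Rge k x z -> exists b, [/\ ozero < b, b <= p & w b = z].
  by move=> xz; apply: wS; rewrite zsP; exact/asboolP.
have [a' [f' M]] := IHm x (ltnW mN) cx; rewrite kS in M.
have p0 : ozero < p by have [b [b0 bp _]] := wS _ xy0; exact: lt_le_trans bp.
exact: (model_power kN cx pw wL p0 wR wS M).
Qed.

End completeness.

Lemma GLP_complete N f Omega : language (upto N) f -> omega_tower N.+2 <= Omega ->
  (forall v : nat -> set (Below Omega), (forall p, Hfam N Omega (v p)) ->
     interp (derivative Omega) v f = setT) -> GLP f.
Proof.
move=> lf OmegaN valid; apply: contrapT => nf.
pose G := box_closure N f.
have GI : forall g h, Imp g h \in G -> g \in G /\ h \in G by move=> g h; exact: box_closure_Imp.
have GB m g : Box m g \in G ->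
    [/\ (m <= N)%N, g \in G & forall j, (j <= N)%N -> Box j g \in G].
  exact: box_closure_Box.
have fG : f \in G by rewrite mem_cat subforms_refl.
have /(@lindenbaum G)[x nx] : ~ derives [:: Neg f] Bot.
  move=> nnf; apply: nf; apply: (@GLP_tautcons [:: foldr Imp Bot [:: Neg f]]).
    by move=> h /=; case: bool_eval.
  by move=> g; rewrite inE => /eqP ->.
have cx : consistent x.
  by move=> xB; apply: nx; apply: derives_sub xB => q qx; rewrite mem_cat qx orbT.
have nxf : ~~ holds x f.
  apply/negP => xf; apply: nx; apply: (@derives_cut _ [:: f; Neg f]).
    by apply: GLP_taut => h /=; case: bool_eval.
  move=> g; rewrite !inE => /predU1P[->|/eqP ->]; apply: derives_in.
    by rewrite mem_cat char_holds// orbT.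
  by rewrite mem_head.
have [a [w [/andP[a0 aO] wa wR wT wL]]] := model_exists GB (leqnn _) cx.
rewrite subnn in wR wT.
have aOm : a < Omega by exact: lt_le_trans OmegaN.
have cw b : ozero < b -> b <= a -> consistent (w b).
  move=> b0; rewrite le_eqVlt => /predU1P[->|ba]; first by rewrite wa.
  by have [] := wR b b0 ba.
(* Variables are read off the labels; the level [N.+1] of [w] puts these sets in [Hfam N]. *)
pose v p := [set y : Below Omega | holds (w (\val y)) (Var p)].
have vH p : Hfam N Omega (v p).
  exact: (@Lv_Hfam _ N Omega w (fun s => holds s (Var p))).
have truth g : g \in G -> forall b, ozero < b -> b <= a ->
    sat (fun p => \val @` v p) g b <-> holds (w b) g.
  elim: g => [p||g IHg h IHh|n g IH] gG b b0 ba /=.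
  - split=> [[y py <-]//|wp].
    by exists (exist (fun y : Ord => y < Omega) b (le_lt_trans ba aOm)).
  - by rewrite holds_Bot//; exact: cw.
  - have [gG' hG'] := GI _ _ gG; rewrite (holds_Imp GI (cw b b0 ba))//.
    rewrite (IHg gG')// (IHh hG')//.
    by split=> [H|/implyP//]; apply/implyP.
  - have [nN gG' _] := GB _ _ gG.
    rewrite (wT b b0 ba n g) ?nN// subn0; apply: pn_eq_pos => // c c0 cb.
    by apply: IH => //; rewrite ltW// (lt_le_trans cb).
have := valid v vH; move/seteqP => -[_ /(_ (exist (fun y : Ord => y < Omega) a aOm) I)].
move=> /interp_sat /(truth f fG a a0 (lexx a)); rewrite wa => xf.
by rewrite xf in nxf.
Qed.

Lemma language_upto f : exists N, language (upto N) f.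
Proof.
have mono N M g : (N <= M)%N -> language (upto N) g -> language (upto M) g.
  move=> NM; elim: g => [p||g IHg h IHh|n g IH] //=.
    by move=> [/IHg ? /IHh ?].
  by move=> [nN /IH ?]; split=> //; exact: leq_trans NM.
elim: f => [p||g [N1 H1] h [N2 H2]|n g [N1 H1]]; [by exists 0%N|by exists 0%N| |].
  exists (maxn N1 N2); split; first by apply: mono H1; exact: leq_maxl.
  by apply: mono H2; exact: leq_maxr.
exists (maxn n N1); split; first exact: leq_maxl.
by apply: mono H1; exact: leq_maxr.
Qed.

Lemma language_setT f : language setT f.
Proof. by elim: f => //= g ->. Qed.

Theorem theorem7p1 :
  (forall (n : nat) (Omega : Ord), omega_tower n.+2 <= Omega ->
     Log (upto n) (derivative Omega) (Hfam n Omega) = GLP_upto n) /\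
  (forall Omega : Ord, epsilon0 <= Omega ->
     Log setT (derivative Omega) (\bigcup_n Hfam n Omega) = GLP).
Proof.
split=> [n Omega nO|Omega eO]; apply/seteqP; split=> f.
- by move=> [lf valid]; split=> //; exact: GLP_complete valid.
- move=> [lf Gf]; split=> // v vH; apply: GLP_sound => // p; by exists n.
- move=> [_ valid]; have [N lN] := language_upto f.
  apply: (GLP_complete lN (le_trans (omega_tower_epsilon0 _) eO)) => v vH.
  by apply: valid => p; exists N.
- by move=> Gf; split=> [|v vH]; [exact: language_setT|exact: GLP_sound].
Qed.
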